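(* Let $\rho\in(0,1)$ and $\alpha\in(0,1)$. For each $n\ge 2$ let $(X_1,\dots,X_n)$ be jointly Gaussian with $X_i\sim N(0,1)$ for every $i$ and $\operatorname{Corr}(X_i,X_j)=\rho$ for all $i\neq j$ (the global null hypothesis). Put $$c_n(\alpha,\rho)=\sqrt{1-\rho}\,\Phi^{-1}\!\left(1-\tfrac1n\right)-\sqrt{\rho}\,\Phi^{-1}(\alpha).$$ Then the procedure that rejects $\mathrm{H}_{0i}$ whenever $X_i>c_n(\alpha,\rho)$ is asymptotically exact under the global null with respect to FWER control, that is, $$\lim_{n\to\infty}\mathrm{FWER}^{I}_{\mathrm{H}_0}(n,\alpha,\rho)=\lim_{n\to\infty}\mathbb{P}\left(\bigcup_{i=1}^n\{X_i>c_n(\alpha,\rho)\}\right)=\alpha.$$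
   Context: $\Phi$ is the standard normal distribution function. One tests $\mathrm{H}_{0i}:\mu_i=0$ versus $\mathrm{H}_{1i}:\mu_i>0$, $i=1,\dots,n$, where $\mu_i$ is the mean of $X_i$; the global null $\mathrm{H}_0$ asserts that all $\mu_i$ are zero. The family-wise error rate (FWER) of a procedure is the probability that it rejects at least one true null hypothesis; $\mathrm{FWER}^{I}_{\mathrm{H}_0}(n,\alpha,\rho)$ is the FWER under the global null of the procedure with cutoff $c_n(\alpha,\rho)$. *)

(* Defs.v *)
From HB Require Import structures.
From mathcomp Require Import all_boot all_order all_algebra.
From mathcomp Require Import all_classical all_reals all_analysis.

Set Implicit Arguments.
Unset Strict Implicit.
Unset Printing Implicit Defensive.

Import numFieldNormedType.Exports.

Local Open Scope classical_set_scope.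
Local Open Scope ring_scope.

Definition Phi (R : realType) (x : R) : R :=
  fine (normal_prob 0 1 `]-oo, x]).

(* [Phi] is a bijection from R onto ]0, 1[; on that interval [Phi_inv p] is the
   unique preimage of [p], and it is the default value 0 elsewhere. *)
Definition Phi_inv (R : realType) (p : R) : R :=
  xget 0 [set x | Phi x = p].

(* [normal_prob m 0] is, by convention, not the point mass at [m], whence the
   separate case of zero standard deviation. *)
Definition gaussian_law (R : realType) (m s : R) : set R -> \bar R :=
  if s == 0 then \d_m else normal_prob m s.

(* The comparison is on measurable sets only, since the values of measures
   elsewhere are meaningless. *)
Definition has_law (d : measure_display) (T : measurableType d) (R : realType)
    (P : probability T R) (Y : T -> R) (mu : set R -> \bar R) : Prop :=
  forall A : set R, measurable A -> P (Y @^-1` A) = mu A.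

(* Every linear combination is Gaussian, possibly degenerate. *)
Definition jointly_gaussian (d : measure_display) (T : measurableType d)
    (R : realType) (P : probability T R) (n : nat)
    (X : 'I_n -> {RV P >-> R}) : Prop :=
  forall a : 'I_n -> R, exists m s : R,
    0 <= s /\ has_law P (fun t => \sum_(i < n) a i * X i t) (gaussian_law m s).

Definition correlation (d : measure_display) (T : measurableType d)
    (R : realType) (P : probability T R) (Y Z : {RV P >-> R}) : R :=
  fine (covariance P Y Z) /
    (Num.sqrt (fine 'V_P[Y]) * Num.sqrt (fine 'V_P[Z])).

(* [H_0i : mu_i = 0], with [mu_i] the mean of [X i]. *)
Definition true_nulls (d : measure_display) (T : measurableType d)
    (R : realType) (P : probability T R) (n : nat)
    (X : 'I_n -> {RV P >-> R}) : set 'I_n :=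
  [set i | ('E_P[X i] = 0)%E].

(* A testing procedure is given by the events [reject i] on which it rejects
   the i-th null hypothesis. *)
Definition FWER (d : measure_display) (T : measurableType d)
    (R : realType) (P : probability T R) (n : nat)
    (X : 'I_n -> {RV P >-> R}) (reject : 'I_n -> set T) : \bar R :=
  P (\bigcup_(i in true_nulls X) reject i).

Definition cutoff_procedure (d : measure_display) (T : measurableType d)
    (R : realType) (P : probability T R) (n : nat)
    (X : 'I_n -> {RV P >-> R}) (c : R) (i : 'I_n) : set T :=
  [set t | c < X i t].

Definition cutoff (R : realType) (n : nat) (alpha rho : R) : R :=
  Num.sqrt (1 - rho) * Phi_inv (1 - n%:R^-1) - Num.sqrt rho * Phi_inv alpha.

(* Main.v *)
(** Write [X_i = Xbar + tau V_i], where [Xbar] is the sample mean and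
    [tau ^ 2 = 1 - rho].  The centred variables [V_i] have variance [1 - 1/n]
    and covariances [- 1/n].  The mean [Xbar] tends in law to [N(0, rho)], so by
    Slutsky's argument, for which the dependence between [Xbar] and the [V_i]
    is irrelevant, it is enough that [max_i V_i - z_n] tends to [0] in
    probability, with [z_n = Phi^-1 (1 - 1/n)].

    From above this is the union bound.  From below, apply the second moment
    method to [\sum_i f (V_i)], where [f] is a Gaussian bump of width about
    [1 / z_n] centred slightly below [z_n].  Joint normality is only known
    through the laws of linear combinations, but since [exp (- y ^ 2 / 2)] is a
    mixture of the functions [y |-> cos (x y)], these laws already give
    [E f (V_i) f (V_j)]: it factors through [V_i - V_j] and [V_i + V_j]. *)
Require Import Defs.
From HB Require Import structures.
From mathcomp Require Import all_boot all_order all_algebra.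
From mathcomp Require Import all_classical all_reals all_analysis.
From mathcomp Require Import measurable_realfun ring lra.
Import numFieldNormedType.Exports.
Import Order.TTheory GRing.Theory Num.Theory.
Local Open Scope classical_set_scope.
Local Open Scope ring_scope.
Set Implicit Arguments.
Unset Strict Implicit.
Unset Printing Implicit Defensive.

(** * Laws of affine images of a standard normal variable *)

(** The form [sqrt rho * Z + tau * xi_i] with independent [Z] and [xi_i] need not be available on
    the given space, whereas the sample mean is a function of the [X_i]. The price, covariances
    [- 1 / n], is harmless: a negative sign keeps [E f (V_i) f (V_j)] essentially below
    [(E f (V_i)) ^ 2]. A bump has full support, so [\sum_i f (V_i)] does not vanish when all [V_i]
    are small. There [f] is compared with a bump [g] of twice the squared width: [f <= k * g], with
    [k] tending to 0. The width [1 / z_n] is the scale on which the normal density changes by a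
    constant factor near [z_n]. It keeps [E g / E f] bounded; a bump of fixed width would draw most
    of its mean from values far below its centre. The centre lies a fixed [eps] below [z_n] because
    [n * E f (V_i)] has to diverge, while centred at [z_n] it would stay bounded. *)

Section normal_measure.
Context {R : realType}.
Local Notation mu := (@lebesgue_measure R).
Local Notation stdn := (@normal_prob R 0 1).

(** The Radon-Nikodym derivative and the density have the same integral over every measurable set,
    hence agree almost everywhere. *)
Lemma ge0_integral_normal_prob (m s : R) (f : R -> \bar R) :
  measurable_fun [set: R] f -> (forall x, 0 <= f x)%E ->
  (\int[normal_prob m s]_x f x = \int[mu]_x (f x * (normal_pdf m s x)%:E))%E.
Proof.
move=> mf f0; have dom := @normal_prob_dominates R m s.
rewrite -(Radon_Nikodym_SigmaFinite.change_of_variables dom f0)//.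
have mpdf : measurable_fun [set: R] (fun x => (normal_pdf m s x)%:E).
  by apply/measurable_EFinP; exact: measurable_normal_pdf.
have mRN : measurable_fun [set: R]
    (Radon_Nikodym_SigmaFinite.f (@normal_prob R m s) mu).
  exact: measurable_int (Radon_Nikodym_SigmaFinite.f_integrable dom).
apply: ge0_ae_eq_integral => //.
- exact: emeasurable_funM.
- exact: emeasurable_funM.
- by move=> x _; rewrite mule_ge0 ?Radon_Nikodym_SigmaFinite.f_ge0.
- by move=> x _; rewrite mule_ge0 ?lee_fin ?normal_pdf_ge0.
apply: ae_eqe_mul2l; apply: integral_ae_eq => //.
- exact: Radon_Nikodym_SigmaFinite.f_integrable.
- by move=> E _ mE; rewrite -Radon_Nikodym_SigmaFinite.f_integral.
Qed.

Lemma probability_eq_cdf (P Q : probability (measurableTypeR R) R) :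
  (forall x : R, P `]-oo, x]%classic = Q `]-oo, x]%classic) ->
  forall A : set R, measurable A -> P A = Q A.
Proof.
move=> PQ A mA.
apply: (@measure_unique _ R (measurableTypeR R)
  (@RGenOInfty.G R) (fun n => `](- n%:R), +oo[%classic)) => //.
- exact: RGenOInfty.measurableE.
- move=> _ _ [x ->] [y ->]; exists (Num.max x y).
  apply/seteqP; split=> z /=; rewrite !in_itv/= !andbT gt_max.
    by move=> [-> ->].
  by move=> /andP[].
- by move=> i; exists (- i%:R).
- rewrite -subTset => x _; exists (Num.truncn (- x)).+1 => //=.
  by rewrite in_itv/= andbT ltrNl truncnS_gt.
- move=> _ [x ->].
  have -> : `]x, +oo[%classic = ~` `]-oo, x]%classic :> set R by rewrite setCitvl.
  rewrite [LHS]probability_setC// [RHS]probability_setC//.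
  by congr (_ - _)%E; exact: PQ.
- by move=> k; rewrite (le_lt_trans (probability_le1 _ _)) ?ltry.
Qed.

Lemma measurable_affine (m s : R) :
  @measurable_fun _ _ (measurableTypeR R) (measurableTypeR R) setT
    (fun z => s * z + m).
Proof. by apply: measurable_funD => //; exact: measurable_funM. Qed.

Lemma normal_pdf_affine (m s z : R) : 0 < s ->
  normal_pdf m s (s * z + m) * s = normal_pdf 0 1 z.
Proof.
move=> s0; rewrite !normal_pdfE ?oner_eq0 ?gt_eqF// /normal_peak /normal_fun.
rewrite subr0 addrK mulrAC; congr (_ * expR _).
- rewrite expr1n mul1r -mulrnAr sqrtrM ?sqr_ge0// sqrtr_sqr gtr0_norm//.
  by rewrite invfM mulrAC mulVf ?mul1r// gt_eqF.
- by rewrite expr1n; field; rewrite gt_eqF.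
Qed.

(** It is enough to compare the two laws on rays []-oo, x]], where this is the substitution
    [y = s * z + m]. *)
Lemma normal_prob_affine (m s : R) (A : set R) : 0 < s -> measurable A ->
  normal_prob m s A = stdn ((fun z => s * z + m) @^-1` A).
Proof.
move=> s0 mA; pose affine z := s * z + m.
have F'E : affine^`()%classic = cst s.
  apply/funext => x; rewrite derive1E /affine deriveD// derive_cst addr0.
  by rewrite deriveZ// derive_id /GRing.scale/= mulr1.
have cF : continuous affine.
  by move=> x; apply: cvgD; [apply: cvgMr; exact: cvg_id|exact: cvg_cst].
pose Q := distribution stdn
  (@mfun_Sub _ _ (measurableTypeR R) (measurableTypeR R) _
    (mem_set (measurable_affine m s))).
suff H x : normal_prob m s `]-oo, x]%classic = Q `]-oo, x]%classic.
  exact: (@probability_eq_cdf (@normal_prob R m s) Q H A mA).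
 rewrite /Q /distribution/= /pushforward /normal_prob.
have xE : x = affine ((x - m) / s).
  by rewrite /affine mulrCA mulfV ?gt_eqF// mulr1 subrK.
have -> : affine @^-1` `]-oo, x]%classic = `]-oo, (x - m) / s]%classic.
  apply/seteqP; split=> z /=; rewrite !in_itv/= /affine ler_pdivlMr// lerBrDr mulrC//.
rewrite [in LHS]xE increasing_ge0_integration_by_substitutionNy//.
- apply: eq_integral => z _; congr EFin.
  by rewrite /= F'E -(normal_pdf_affine m z s0).
- by move=> y z _ _ yz; rewrite /affine ltrD2r ltr_pM2l.
- by move=> y _; rewrite F'E; exact: cvg_cst.
- by rewrite F'E; exact: is_cvg_cst.
- by rewrite F'E; exact: cvg_cst.
- split; last by apply: cvg_at_left_filter; exact: cF.
  by move=> y _; apply: derivableD => //; exact: derivableM.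
- rewrite /affine; apply/cvgrNyPle => B.
  have := nbhs_ninfty_le (num_real ((B - m) / s)).
  by apply: filterS => y; rewrite -lerBrDr (mulrC s) -ler_pdivlMr.
- by apply: continuous_subspaceT; apply: continuous_normal_pdf; rewrite gt_eqF.
- by move=> y _; exact: normal_pdf_ge0.
Qed.

End normal_measure.

(** As an image of the standard law, the point mass is simply the case [s = 0], so the same formulas
    cover degenerate combinations, such as [V_i + V_j] when [n = 2]. *)
Definition normal_law d (T : measurableType d) (R : realType)
    (P : probability T R) (Y : T -> R) (m s : R) : Prop :=
  forall A : set R, measurable A ->
    P (Y @^-1` A) = normal_prob 0 1 ((fun z => s * z + m) @^-1` A).

Section normal_law.
Context d (T : measurableType d) (R : realType) (P : probability T R).
Local Notation mu := (@lebesgue_measure R).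
Local Notation stdn := (@normal_prob R 0 1).
Variables (Y : T -> R) (m s : R).
Hypothesis mY : measurable_fun [set: T] Y.

Lemma normal_law_gaussian : 0 <= s -> has_law P Y (gaussian_law m s) ->
  normal_law P Y m s.
Proof.
move=> s0 + A mA => /(_ A mA) ->; rewrite /gaussian_law.
have [->|sN0] := eqVneq s 0; last first.
  by rewrite normal_prob_affine// lt_neqAle eq_sym sN0.
under eq_fun do rewrite mul0r add0r.
rewrite preimage_cst diracE; case: ifPn => mA'.
  by rewrite probability_setT.
by rewrite measure0.
Qed.

Let mA : @measurable_fun _ _ (measurableTypeR R) R setT (fun z => s * z + m).
Proof. exact: measurable_affine. Qed.

Hypothesis lawY : normal_law P Y m s.

Lemma ge0_integral_normal_law (f : R -> \bar R) :
  measurable_fun [set: R] f -> (forall x, 0 <= f x)%E ->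
  (\int[P]_t f (Y t) = \int[stdn]_z f (s * z + m)%R)%E.
Proof.
move=> mf f0.
transitivity (\int[pushforward P Y]_y f y)%E.
  by rewrite ge0_integral_pushforward.
rewrite (@eq_measure_integral _ _ _ _ (pushforward stdn (fun z => s * z + m))).
  by rewrite (ge0_integral_pushforward mA).
by move=> A mA' _; exact: lawY.
Qed.

Lemma normal_law_integrable (g : R -> R) : measurable_fun [set: R] g ->
  stdn.-integrable setT (fun z => (g (s * z + m))%:E) ->
  P.-integrable setT (fun t => (g (Y t))%:E).
Proof.
move=> mg /integrableP[_ ig]; apply/integrableP; split.
  by apply/measurable_EFinP; exact: measurableT_comp.
rewrite (@ge0_integral_normal_law (fun x => `|(g x)%:E|)%E)//.
by do 2 apply: measurableT_comp => //.
Qed.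

Lemma Rintegral_normal_law (g : R -> R) : measurable_fun [set: R] g ->
  stdn.-integrable setT (fun z => (g (s * z + m))%:E) ->
  \int[P]_t g (Y t) = \int[stdn]_z g (s * z + m).
Proof.
move=> mg ig; congr fine.
transitivity ((\int[pushforward P Y]_y (g y)%:E)%E).
  rewrite integral_pushforward//; first exact/measurable_EFinP.
  exact: normal_law_integrable.
rewrite (@eq_measure_integral _ _ _ _ (pushforward stdn (fun z => s * z + m))).
  by rewrite (integral_pushforward mA)//; exact/measurable_EFinP.
by move=> A mA' _; exact: lawY.
Qed.

End normal_law.

(** * Stein's identity and the characteristic function *)

Section stein.
Context {R : realType}.
Local Notation mu := (@lebesgue_measure R).
Local Notation stdn := (@normal_prob R 0 1).

Lemma integral_normal_prob (m s : R) (f : R -> \bar R) :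
  (@normal_prob R m s).-integrable setT f ->
  (\int[normal_prob m s]_x f x = \int[mu]_x (f x * (normal_pdf m s x)%:E))%E.
Proof.
move=> intf; have mf := measurable_int _ intf.
have mp : measurable_fun [set: R] (fun x => (normal_pdf m s x)%:E).
  by apply/measurable_EFinP; exact: measurable_normal_pdf.
rewrite integralE (ge0_integral_normal_prob _ _ (measurable_funepos mf))//.
rewrite (ge0_integral_normal_prob _ _ (measurable_funeneg mf))//.
rewrite [RHS]integralE; congr (_ - _)%E; apply: eq_integral => x _.
  by rewrite !funeposE maxe_pMl ?mul0e ?lee_fin ?normal_pdf_ge0.
by rewrite !funenegE maxe_pMl ?mul0e ?mulNe ?lee_fin ?normal_pdf_ge0.
Qed.

Lemma integrable_normal_prob (m s : R) (f : R -> \bar R) :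
  (@normal_prob R m s).-integrable setT f ->
  mu.-integrable setT (fun x => f x * (normal_pdf m s x)%:E)%E.
Proof.
move=> /integrableP[mf intf]; apply/integrableP; split.
  apply: emeasurable_funM => //.
  by apply/measurable_EFinP; exact: measurable_normal_pdf.
move: intf; rewrite ge0_integral_normal_prob//; last exact: measurableT_comp.
congr (_ < _)%E; apply: eq_integral => x _.
by rewrite abseM (@gee0_abs _ (normal_pdf m s x)%:E)// lee_fin normal_pdf_ge0.
Qed.

(** Multiplying by [exp (x ^ 2 / 4)] turns the density of N(0, 1) into [sqrt 2] times that of N(0,
    2). *)
Lemma integrable_stdn_expR : stdn.-integrable setT (fun x => (expR (x ^+ 2 / 4))%:E).
Proof.
have me : measurable_fun [set: R] (fun x => (expR (x ^+ 2 / 4))%:E).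
  apply/measurable_EFinP; apply: measurableT_comp => //.
  by apply: measurable_funM.
apply/integrableP; split => //.
under eq_integral do rewrite gee0_abs ?lee_fin ?expR_ge0//.
rewrite ge0_integral_normal_prob//.
have s2 : Num.sqrt 2 != 0 :> R by rewrite sqrtr_eq0 -ltNge.
under eq_integral => x _.
  rewrite (_ : (_ * _)%E = ((Num.sqrt 2)%:E * (normal_pdf 0 (Num.sqrt 2) x)%:E)%E).
    over.
  rewrite -!EFinM; congr EFin; rewrite !normal_pdfE ?oner_eq0//.
  rewrite /normal_peak /normal_fun subr0 expr1n mul1r sqr_sqrtr// -mulrnAr.
  rewrite sqrtrM// invfM mulrCA -expRD mulrA mulrA mulfV// mul1r.
  by congr (_ * expR _); field.
rewrite ge0_integralZl//.
- by rewrite integral_normal_pdf mule1 ltry.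
- by apply/measurable_EFinP; exact: measurable_normal_pdf.
- by move=> x _; rewrite lee_fin normal_pdf_ge0.
Qed.

(** By [1 + y <= exp y], quadratic growth is dominated by [4 * exp (x ^ 2 / 4)]. *)
Lemma integrable_stdn (C : R) (f : R -> R) : measurable_fun [set: R] f ->
  (forall x, `|f x| <= C * (1 + x ^+ 2)) ->
  stdn.-integrable setT (fun x => (f x)%:E).
Proof.
move=> mf fC.
apply: (@le_integrable _ (measurableTypeR R) R stdn setT measurableT
    (fun x => (f x)%:E) (fun x => (4 * C)%:E * (expR (x ^+ 2 / 4))%:E)%E).
- exact/measurable_EFinP.
- move=> x _; rewrite -EFinM/= lee_fin; apply: (le_trans (fC x)).
  apply: le_trans (ler_norm _).
  have C0 : 0 <= C.
    have := fC 0; rewrite expr0n/= addr0 mulr1; exact: le_trans.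
  rewrite [4 * C]mulrC -mulrA ler_wpM2l//.
  have := expR_ge1Dx (x ^+ 2 / 4); lra.
- by apply: integrableZl => //; exact: integrable_stdn_expR.
Qed.
End stein.

Section char_fun.
Context {R : realType}.
Local Notation mu := (@lebesgue_measure R).
Local Notation stdn := (@normal_prob R 0 1).

Let p (x : R) : R := normal_peak 1 * expR (- (x ^+ 2 / 2)).

Let pE : normal_pdf 0 1 = p :> (R -> R).
Proof.
apply/funext => x; rewrite normal_pdfE ?oner_eq0// /p /normal_fun.
by congr (_ * expR _); rewrite subr0 expr1n mulNr.
Qed.

Let is_derive_p (x : R) : is_derive x 1 p (- x * p x).
Proof.
have H : is_derive x 1 (fun y : R => - (y ^+ 2 / 2)) (- x).
  apply: is_derive_eq; rewrite /GRing.scale/=; lra.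
have H2 := @is_derive1_comp _ expR (fun y : R => - (y ^+ 2 / 2)) x _ _
  (is_derive_expR _) H.
by apply: is_derive_eq; rewrite /p /GRing.scale/=; ring.
Qed.

(** Since [p' x = - x * p x], the integrand times the density is the derivative of [F * p]; over
    growing symmetric intervals only boundary terms remain, and they vanish in the limit. *)
Lemma stein_identity (F F' : R -> R) (C : R) :
  (forall x : R, is_derive x 1 F (F' x)) -> continuous F' ->
  (forall x, `|F x| <= C * (1 + `|x|)) -> (forall x, `|F' x| <= C) ->
  \int[stdn]_z (F' z - z * F z) = 0.
Proof.
move=> dF cF' FC F'C.
have C0 : 0 <= C by exact: le_trans (F'C 0).
have cF : continuous F.
  move=> x; apply/differentiable_continuous/derivable1_diffP.
  by have [] := dF x.
have cp : continuous p.
  move=> x; apply/differentiable_continuous/derivable1_diffP.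
  by have [] := is_derive_p x.
pose g x := F' x - x * F x.
have cg : continuous g.
  move=> x; apply: cvgB; first exact: cF'.
  by apply: cvgM; [exact: cvg_id|exact: cF].
have ig : stdn.-integrable setT (fun x => (g x)%:E).
  apply: (@integrable_stdn _ (2 * C)); first exact: continuous_measurable_fun.
  move=> x; apply: (le_trans (ler_normB _ _)); rewrite normrM.
  have h1 := F'C x; have h2 := FC x.
  have h3 : `|x| * `|F x| <= `|x| * (C * (1 + `|x|)) by rewrite ler_wpM2l.
  have -> : x ^+ 2 = `|x| ^+ 2 by rewrite real_normK ?num_real.
  have h4 : 0 <= C * (1 - `|x|) ^+ 2 by rewrite mulr_ge0 ?sqr_ge0.
  nra.
rewrite /Rintegral integral_normal_prob// pE.
have igp : mu.-integrable setT (fun x => (g x * p x)%:E).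
  by have := integrable_normal_prob ig; rewrite pE.
(* With [n.+1] every interval is nondegenerate and the boundary terms compare with [harmonic n]. *)
pose I n : set R := `[(- n.+1%:R), n.+1%:R]%classic.
have lim1 : (\int[mu]_x (((fun x => g x * p x) \_ (I n)) x)%:E)%E @[n --> \oo] -->
    (\int[mu]_x (g x * p x)%:E)%E.
  apply: (@dominated_cvg _ (measurableTypeR R) R mu setT measurableT
    (fun n x => (((fun x => g x * p x) \_ (I n)) x)%:E)
    (fun x => (g x * p x)%:E) (fun x => `|(g x * p x)%:E|%E)) => //.
  - move=> n; apply/measurable_EFinP.
    apply/(measurable_restrictT _ _).1 => //; first exact: measurable_itv.
    apply: measurable_funTS; apply: continuous_measurable_fun => x.
    by apply: cvgM; [exact: cg|exact: cp].
  - move=> x _; apply: cvg_near_cst; near=> n.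
    rewrite patchE mem_set// /I /= in_itv/= -ler_norml.
    rewrite (le_trans _ (_ : n%:R <= _)) ?ler_nat//.
    by near: n; exact: nbhs_infty_ger.
  - exact: integrable_abse.
  - move=> n x _; rewrite patchE; case: ifPn => _ //.
    by rewrite /point/= normr0 lee_fin.
have FTC n : (\int[mu]_x (((fun x => g x * p x) \_ (I n)) x)%:E)%E =
    (F n.+1%:R * p n.+1%:R - F (- n.+1%:R) * p (- n.+1%:R))%:E.
  rewrite (_ : (fun x => _) = (EFin \o (fun x => g x * p x)) \_ (I n)); last first.
    by rewrite restrict_EFin.
  rewrite -integral_mkcond.
  have dFp (x : R) : is_derive x 1 (F * p) (g x * p x).
    apply: (is_derive_eq (is_deriveM (dF x) (is_derive_p x))).
    by rewrite /g /GRing.scale/=; ring.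
  have cFp : continuous (F * p).
    by move=> x; apply: cvgM; [exact: cF|exact: cp].
  rewrite (@continuous_FTC2 _ _ (F * p)) ?EFinB//.
  - by rewrite ltrNl (lt_trans (_ : _ < 0))// oppr_lt0.
  - apply: continuous_subspaceT => x.
    by apply: cvgM; [exact: cg|exact: cp].
  - split=> [x _||]; first by have [] := dFp x.
      by apply: cvg_at_right_filter; exact: cFp.
    by apply: cvg_at_left_filter; exact: cFp.
  - by move=> x _; rewrite derive1E; have [_ ->] := dFp x.
(* [F] grows at most linearly, and [1 + y ^ 2 / 2 <= exp (y ^ 2 / 2)] already makes [p y * (1 + y)]
   of order [1 / y]. *)
have pub n : p n.+1%:R * (1 + n.+1%:R) <= 4 * normal_peak 1 * n.+1%:R^-1.
  rewrite /p expRN.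
  have := expR_ge1Dx (n.+1%:R ^+ 2 / 2 : R).
  set e := expR _; set y : R := n.+1%:R => ey.
  have y0 : 0 < y by rewrite ltr0n.
  clearbody e y.

  have e0 : 0 < e by nra.
  have h : e^-1 * (1 + y) <= 4 * y^-1.
    rewrite mulrC ler_pdivrMr// mulrAC ler_pdivlMr//.
    have := sqr_ge0 (y - 1); rewrite !expr2 in ey *; lra.
  have := ler_wpM2l (normal_peak_ge0 1) h; lra.
suff lim0 : (\int[mu]_x (((fun x => g x * p x) \_ (I n)) x)%:E)%E @[n --> \oo] -->
    0%E by rewrite (cvg_unique _ lim1 lim0).
under eq_fun do rewrite FTC.
apply: cvg_EFin; first exact: nearW.
apply/norm_cvg0P.
apply: (@squeeze_cvgr _ _ _ _ (cst 0) (fun n => 8 * C * normal_peak 1 * harmonic n)).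
- near=> n; rewrite normr_ge0/=.
  have pN : p (- n.+1%:R) = p n.+1%:R by rewrite /p sqrrN.
  have p0 : 0 <= p n.+1%:R by rewrite mulr_ge0 ?normal_peak_ge0 ?expR_ge0.
  rewrite pN -mulrBl normrM (ger0_norm p0).
  have h1 := FC n.+1%:R; have h2 := FC (- n.+1%:R).
  rewrite (normrN n.+1%:R) in h2; rewrite normr_nat in h1 h2.
  have h3 := ler_normB (F n.+1%:R) (F (- n.+1%:R)).
  have h4 : C * (p n.+1%:R * (1 + n.+1%:R)) <= C * (4 * normal_peak 1 * n.+1%:R^-1).
    by rewrite ler_wpM2l.
  have : `|F n.+1%:R - F (- n.+1%:R)| * p n.+1%:R <=
      2 * (C * (1 + n.+1%:R)) * p n.+1%:R by rewrite ler_wpM2r//; lra.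
  move=> /le_trans; apply; rewrite /harmonic/=.
  rewrite (_ : 2 * _ * _ = 2 * (C * (p n.+1%:R * (1 + n.+1%:R)))); last by ring.
  rewrite (_ : 8 * _ * _ * _ = 2 * (C * (4 * normal_peak 1 * n.+1%:R^-1))); last by ring.
  by rewrite ler_wpM2l.
- exact: cvg_cst.
- by rewrite -[X in _ --> X](mulr0 (8 * C * normal_peak 1)); apply: cvgMr; exact: cvg_harmonic.
Unshelve. all: by end_near. Qed.

End char_fun.

Lemma Rintegral_probability_cst d (T : measurableType d) (R : realType)
  (P : probability T R) (c : R) : \int[P]_t c = c.
Proof. by rewrite Rintegral_cst// (congr1 fine (probability_setT P)) mulr1. Qed.

Section stdn_moments.
Context {R : realType}.
Local Notation stdn := (@normal_prob R 0 1).

Lemma integrable_stdn_id : stdn.-integrable setT (fun x => x%:E).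
Proof.
apply: (@integrable_stdn _ 1) => // x; rewrite mul1r.
have -> : x ^+ 2 = `|x| ^+ 2 by rewrite real_normK ?num_real.
have := sqr_ge0 (`|x| - 1); rewrite sqrrB; nra.
Qed.

Lemma integrable_stdn_sqr : stdn.-integrable setT (fun x => (x ^+ 2)%:E).
Proof.
apply: (@integrable_stdn _ 1) => // x.
by rewrite mul1r ger0_norm ?sqr_ge0// lerDr.
Qed.

Lemma integrable_stdn_bounded (C : R) (f : R -> R) :
  measurable_fun [set: R] f -> (forall x, `|f x| <= C) ->
  stdn.-integrable setT (fun x => (f x)%:E).
Proof.
move=> mf fC; apply: (@integrable_stdn _ C) => // x.
apply: le_trans (fC x) _; rewrite ler_peMr ?lerDl ?sqr_ge0//.
exact: le_trans (fC x).
Qed.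

Lemma stdn_mean : \int[stdn]_z z = 0.
Proof.
have : \int[stdn]_z (0 - z * 1) = 0.
  apply: (@stein_identity _ (cst 1) (cst 0) 1) => [x|x|x].
  - exact: cvg_cst.
  - by rewrite /= normr1 mul1r lerDl.
  - by rewrite /= normr0.
under eq_Rintegral do rewrite sub0r mulr1 -mulN1r.
rewrite RintegralZl//; last exact: integrable_stdn_id.
by move=> /eqP; rewrite mulN1r oppr_eq0 => /eqP.
Qed.

Lemma stdn_sqr : \int[stdn]_z (z ^+ 2) = 1.
Proof.
have : \int[stdn]_z (1 - z * z) = 0.
  apply: (@stein_identity _ id (cst 1) 1) => [x|x|x].
  - exact: cvg_cst.
  - by rewrite mul1r lerDr.
  - by rewrite /= normr1.
under eq_Rintegral do rewrite -expr2.
rewrite RintegralB//; last exact: integrable_stdn_sqr.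
  by rewrite Rintegral_probability_cst => /eqP; rewrite subr_eq0 => /eqP.
by apply: (@integrable_stdn_bounded 1) => // x; rewrite normr1.
Qed.

Lemma measurable_cos_affine (t th : R) :
  measurable_fun [set: R] (fun z => cos (t * z + th)).
Proof.
apply: continuous_measurable_fun => x; apply: (continuous_comp (f := fun z => t * z + th)).
  by apply: cvgD; [apply: cvgMr; exact: cvg_id|exact: cvg_cst].
exact: continuous_cos.
Qed.

(* As a function of [t] the integral solves [y' = - t y], by Stein's identity
   for [sin (t z + th)]. *)
Lemma stdn_cos (t th : R) :
  \int[stdn]_z cos (t * z + th) = cos th * expR (- (t ^+ 2 / 2)).
Proof.
pose phi t := \int[stdn]_z cos (t * z + th).
have icos t' : stdn.-integrable setT (fun z => (cos (t' * z + th))%:E).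
  apply: (@integrable_stdn_bounded 1); first exact: measurable_cos_affine.
  by move=> x; exact: cos_max.
have msin t' : measurable_fun [set: R] (fun z => sin (t' * z + th)).
  apply: continuous_measurable_fun => x.
  apply: (continuous_comp (f := fun z => t' * z + th)).
    by apply: cvgD; [apply: cvgMr; exact: cvg_id|exact: cvg_cst].
  exact: continuous_sin.
have izsin t' : stdn.-integrable setT (fun z => (z * sin (t' * z + th))%:E).
  apply: (@integrable_stdn _ 1); first by apply: measurable_funM.
  move=> x; rewrite mul1r normrM.
  have h : `|x| * `|sin (t' * x + th)| <= `|x| * 1 by rewrite ler_wpM2l ?sin_max.
  have -> : x ^+ 2 = `|x| ^+ 2 by rewrite real_normK ?num_real.
  have := sqr_ge0 (`|x| - 1); rewrite sqrrB; nra.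
have dcos (z x : R) : is_derive x 1 (fun u => cos (u * z + th)) (- z * sin (x * z + th)).
  have H : is_derive x 1 (fun u : R => u * z + th) z.
    by apply: is_derive_eq; rewrite /GRing.scale/=; ring.
  apply: (is_derive_eq (@is_derive1_comp _ cos (fun u : R => u * z + th) x _ _
    (is_derive_cos _) H)); ring.
have dphi (x : R) : is_derive x 1 phi (- x * phi x).
  have d1E u z : partial1of2 (fun t z => cos (t * z + th)) u z = - z * sin (u * z + th).
    by rewrite partial1of2E; have [_ ->] := dcos z u.
  have xI : x \in `]x - 1, x + 1[ by rewrite in_itv/= ltrDl ltrBlDr ltrDl ltr01.
  have iabs : stdn.-integrable setT (EFin \o (fun z : R => `|z|)).
    by have /integrable_abse := integrable_stdn_id.
  have bnd : forall u z : R, [set` `]x - 1, x + 1[] u -> [set: R] z ->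
      `|partial1of2 (fun t z => cos (t * z + th)) u z| <= `|z|.
    by move=> u z _ _; rewrite d1E normrM normrN ler_piMr// sin_max.
  have H1 := @derivable_under_integral R _ (measurableTypeR R) stdn
    (fun t z => cos (t * z + th)) setT measurableT x _ _ xI
    (fun u _ => icos u) (fun u z _ _ => @ex_derive _ _ _ _ _ _ _ (dcos z u)) (fun z => `|z|)
    (fun z => normr_ge0 z) iabs bnd.
  have H2 := @differentiation_under_integral R _ (measurableTypeR R) stdn
    (fun t z => cos (t * z + th)) setT measurableT x _ _ xI
    (fun u _ => icos u) (fun u z _ _ => @ex_derive _ _ _ _ _ _ _ (dcos z u)) (fun z => `|z|)
    (fun z => normr_ge0 z) iabs bnd.
  apply: DeriveDef; first exact: H1.
  rewrite -derive1E H2.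
  under eq_Rintegral do rewrite d1E mulNr -mulN1r.
  rewrite RintegralZl//; last exact: izsin.
  have : \int[stdn]_z (x * cos (x * z + th) - z * sin (x * z + th)) = 0.
    apply: (@stein_identity _ (fun z => sin (x * z + th)) _ (`|x| + 1)).
    - move=> z; have H : is_derive z 1 (fun u : R => x * u + th) x.
        by apply: is_derive_eq; rewrite /GRing.scale/=; ring.
      apply: (is_derive_eq (@is_derive1_comp _ sin (fun u : R => x * u + th) z _ _
        (is_derive_sin _) H)); ring.
    - move=> z; apply: cvgMr; apply: (continuous_comp (f := fun z => x * z + th)).
        by apply: cvgD; [apply: cvgMr; exact: cvg_id|exact: cvg_cst].
      exact: continuous_cos.
    - move=> z; apply: (le_trans (sin_max _)); rewrite -[leLHS]mulr1 ler_pM//.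
        by rewrite lerDr.
      by rewrite lerDl.
    - by move=> z; rewrite normrM (le_trans (ler_wpM2l _ (cos_max _)))// mulr1 lerDl.
  have ixcos : stdn.-integrable setT (fun z => (x * cos (x * z + th))%:E).
    apply: (@integrable_stdn_bounded `|x|).
      by apply: measurable_funM => //; exact: measurable_cos_affine.
    by move=> z; rewrite normrM ler_piMr// cos_max.
  rewrite RintegralB//; last exact: izsin.
  rewrite RintegralZl//; last exact: icos.
  rewrite -/(phi x) => /eqP; rewrite subr_eq0 => /eqP <-.
  by rewrite mulN1r mulNr.
(* The integrating factor makes the solution constant, with value [cos th] at 0. *)
have dpsi (x : R) : is_derive x 1 (fun t => phi t * expR (t ^+ 2 / 2)) 0.
  have H : is_derive x 1 (fun u : R => u ^+ 2 / 2) x.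
    by apply: is_derive_eq; rewrite /GRing.scale/=; lra.
  have H2 := @is_derive1_comp _ expR (fun u : R => u ^+ 2 / 2) x _ _
    (is_derive_expR _) H.
  by apply: (is_derive_eq (is_deriveM (dphi x) H2)); rewrite /GRing.scale/=; ring.
have := is_derive_0_is_cst t 0 dpsi.
rewrite expr0n/= mul0r expR0 mulr1 {2}/phi.
under eq_Rintegral do rewrite mul0r add0r.
rewrite Rintegral_probability_cst => <-.
by rewrite -mulrA -expRD subrr expR0 mulr1.
Qed.

End stdn_moments.

(** * Gaussian bumps *)

Section bounded_integrals.
Context d (T : measurableType d) (R : realType) (P : probability T R).

Lemma integrable_bounded (C : R) (f : T -> R) : measurable_fun [set: T] f ->
  (forall t, `|f t| <= C) -> P.-integrable setT (EFin \o f).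
Proof.
move=> mf fC; apply: measurable_bounded_integrable => //.
  by rewrite (le_lt_trans (probability_le1 _ _)) ?ltry.
exists C; split; first exact: num_real.
by move=> x Cx y _; apply: le_trans (fC y) (ltW Cx).
Qed.

Lemma EFin_Rintegral_bounded (C : R) (f : T -> R) : measurable_fun [set: T] f ->
  (forall t, `|f t| <= C) -> (\int[P]_t (f t)%:E = (\int[P]_t f t)%:E)%E.
Proof.
move=> mf fC; rewrite /Rintegral fineK//.
exact: integrable_fin_num (integrable_bounded mf fC).
Qed.

End bounded_integrals.

Lemma Rintegral_Fubini_bounded d1 d2 (T1 : measurableType d1)
    (T2 : measurableType d2) (R : realType) (P1 : probability T1 R)
    (P2 : probability T2 R) (C : R) (f : T1 * T2 -> R) :
  measurable_fun [set: T1 * T2] f -> (forall z, `|f z| <= C) ->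
  \int[P1]_x \int[P2]_y f (x, y) = \int[P2]_y \int[P1]_x f (x, y).
Proof.
move=> mf fC.
have m1 x : measurable_fun [set: T2] (fun y => f (x, y)).
  by apply: measurableT_comp.
have m2 y : measurable_fun [set: T1] (fun x => f (x, y)).
  by apply: measurableT_comp.
rewrite /Rintegral; congr fine.
transitivity (\int[P1]_x \int[P2]_y (f (x, y))%:E)%E.
  by apply: eq_integral => x _; rewrite (EFin_Rintegral_bounded _ (m1 x) (fun y => fC (x, y))).
transitivity (\int[P2]_y \int[P1]_x (f (x, y))%:E)%E; last first.
  by apply: eq_integral => y _; rewrite (EFin_Rintegral_bounded _ (m2 y) (fun x => fC (x, y))).
apply: (@Fubini _ _ _ _ _ P1 P2 (EFin \o f)).
apply/integrable12ltyP; first exact/measurable_EFinP.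
apply: (@le_lt_trans _ _ (\int[P1]_x C%:E)%E); last first.
  by rewrite integral_cst// [X in (_ * X)%E](probability_setT P1) mule1 ltry.
apply: ge0_le_integral => //.
- by move=> x _; apply: integral_ge0.
- apply: (@measurable_fun_fubini_tonelli_F _ _ _ _ _ P2
    (fun z => `|(f z)%:E|%E)) => //.
  by apply: measurableT_comp => //; exact/measurable_EFinP.
move=> x _; apply: (@le_trans _ _ (\int[P2]_y C%:E)%E).
  apply: ge0_le_integral => //.
  - by apply: measurableT_comp => //; exact/measurable_EFinP.
  - by move=> y _; rewrite /= lee_fin.
by rewrite integral_cst// [X in (_ * X)%E](probability_setT P2) mule1.
Qed.

Lemma Rintegral_normal_law_cos d (T : measurableType d) (R : realType)
    (P : probability T R) (Y : T -> R) (s c : R) :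
  measurable_fun [set: T] Y -> normal_law P Y 0 s ->
  \int[P]_t cos (Y t + c) = cos c * expR (- (s ^+ 2 / 2)).
Proof.
move=> mY lY; have mc : measurable_fun [set: R] (fun y : R => cos (y + c)).
  by have := measurable_cos_affine 1 c; under eq_fun do rewrite mul1r.
rewrite (Rintegral_normal_law mY lY mc).
  by under eq_Rintegral do rewrite addr0; exact: stdn_cos.
under eq_fun do rewrite addr0.
apply: (@integrable_stdn_bounded _ 1); first exact: measurable_cos_affine.
by move=> z; exact: cos_max.
Qed.

Section gaussian_bumps.
Context d (T : measurableType d) (R : realType) (P : probability T R).
Local Notation stdn := (@normal_prob R 0 1).
Implicit Types U V W Y : T -> R.

(** With height 1, this is both the test function of the second moment method and the characteristic
    function of N(0, 1). *)
Definition gbump (y : R) : R := expR (- (y ^+ 2 / 2)).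

Lemma gbump_ge0 y : 0 <= gbump y. Proof. exact: expR_ge0. Qed.

Lemma gbump_le1 y : gbump y <= 1.
Proof. by rewrite expR_le1 oppr_le0 divr_ge0 ?sqr_ge0. Qed.

Lemma normr_gbump y : `|gbump y| <= 1.
Proof. by rewrite ger0_norm ?gbump_ge0 ?gbump_le1. Qed.

Lemma continuous_gbump : continuous gbump.
Proof.
move=> x; apply: continuous_comp; last exact: continuous_expR.
by apply: cvgN; apply: cvgMl; exact: exprn_continuous.
Qed.

Lemma measurable_gbump Y : measurable_fun [set: T] Y ->
  measurable_fun [set: T] (fun t => gbump (Y t)).
Proof.
move=> mY; apply: (measurableT_comp (f := gbump)) => //.
exact: continuous_measurable_fun continuous_gbump.
Qed.

Lemma measurable_cos_comp Y : measurable_fun [set: T] Y ->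
  measurable_fun [set: T] (fun t => cos (Y t)).
Proof.
move=> mY; apply: (measurableT_comp (f := cos)) => //.
exact: continuous_measurable_fun (@continuous_cos R).
Qed.

(** By [stdn_cos] with the frequency and the variable exchanged, [gbump (U t)] is the mean of
    [cos (x * U t)] over standard normal [x]; boundedness of [W] allows Fubini. *)
Lemma Rintegral_gbumpM U W (C : R) :
  measurable_fun [set: T] U -> measurable_fun [set: T] W ->
  (forall t, `|W t| <= C) ->
  \int[P]_t (gbump (U t) * W t) = \int[stdn]_x \int[P]_t (cos (x * U t) * W t).
Proof.
move=> mU mW WC.
rewrite -(@Rintegral_Fubini_bounded _ _ _ _ _ P stdn C
  (fun z => cos (z.2 * U z.1) * W z.1)); last 2 first.
- apply: measurable_funM; last exact: measurableT_comp.
  apply: (measurableT_comp (f := cos)).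
    exact: continuous_measurable_fun (@continuous_cos R).
  by apply: measurable_funM => //; exact: measurableT_comp.
- move=> z; rewrite normrM; apply: le_trans (WC z.1).
  by rewrite ler_piMl// cos_max.
apply: eq_Rintegral => t _ /=.
rewrite RintegralZr//; last first.
  apply: (@integrable_stdn_bounded _ 1); last by move=> x; exact: cos_max.
  by have := measurable_cos_affine (U t) 0; under eq_fun do rewrite addr0 mulrC.
congr (_ * _); have := stdn_cos (U t) 0; rewrite cos0 mul1r /gbump => <-.
by apply: eq_Rintegral => x _; rewrite addr0 mulrC.
Qed.

(** The mixture formula is applied to [U] with weight [cos (y * V t)], then to [V] with weight
    [gbump (U t)]; used with a constant weight, it also reassembles each factor. Cosines suffice
    because [gbump] is even. *)
Lemma gbump_independent U V :
  measurable_fun [set: T] U -> measurable_fun [set: T] V ->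
  (forall x y, \int[P]_t (cos (x * U t) * cos (y * V t)) =
    \int[P]_t cos (x * U t) * \int[P]_t cos (y * V t)) ->
  \int[P]_t (gbump (U t) * gbump (V t)) =
    \int[P]_t gbump (U t) * \int[P]_t gbump (V t).
Proof.
move=> mU mV indep.
have mcos Y x : measurable_fun [set: T] Y ->
    measurable_fun [set: T] (fun t => cos (x * Y t)).
  by move=> mY; apply: measurable_cos_comp; exact: measurable_funM.
have icos Y x : measurable_fun [set: T] Y ->
    P.-integrable setT (EFin \o (fun t => cos (x * Y t))).
  by move=> mY; apply: (@integrable_bounded _ _ _ _ 1 _ (mcos _ _ mY)) => t; exact: cos_max.
have ib Y : measurable_fun [set: T] Y ->
    P.-integrable setT (EFin \o (fun t => gbump (Y t))).
  move=> mY; apply: (@integrable_bounded _ _ _ _ 1 _ (measurable_gbump mY)) => t.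
  exact: normr_gbump.
have half y : \int[P]_t (gbump (U t) * cos (y * V t)) =
    \int[P]_t gbump (U t) * \int[P]_t cos (y * V t).
  rewrite (@Rintegral_gbumpM _ _ 1 mU (mcos _ y mV)); last by move=> t; exact: cos_max.
  under eq_Rintegral => x _ do rewrite indep -(RintegralZr _ measurableT (icos _ x mU)).
  rewrite -(RintegralZr _ measurableT (ib _ mU)).
  by rewrite (@Rintegral_gbumpM _ (cst _) `|\int[P]_t cos (y * V t)| mU).
under eq_Rintegral do rewrite mulrC.
rewrite (@Rintegral_gbumpM _ _ 1 mV (measurable_gbump mU)); last first.
  by move=> t; exact: normr_gbump.
under eq_Rintegral => y _.
  under eq_Rintegral do rewrite mulrC.
  rewrite half mulrC -(RintegralZr _ measurableT (icos _ y mV)).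
  over.
rewrite [RHS]mulrC -(RintegralZr _ measurableT (ib _ mV)).
by rewrite (@Rintegral_gbumpM _ (cst _) `|\int[P]_t gbump (U t)| mV).
Qed.

(** Completing the square writes the integrand as [S * c] times the density of mean [M] and standard
    deviation [S]: the posterior of [z] when [s * z] is observed to be [m] with noise variance
    [v]. *)
Lemma stdn_gbump (s m v : R) : 0 < v ->
  \int[stdn]_z gbump ((s * z - m) / Num.sqrt v) =
  Num.sqrt (v / (v + s ^+ 2)) * expR (- (m ^+ 2 / (2 * (v + s ^+ 2)))).
Proof.
move=> v0; have w0 : 0 < v + s ^+ 2 by rewrite ltr_pwDl ?sqr_ge0.
set c := expR (- (m ^+ 2 / _)); set S := Num.sqrt (v / _).
have S0 : S != 0 by rewrite gt_eqF// sqrtr_gt0 divr_gt0.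
have S2 : S ^+ 2 = v / (v + s ^+ 2) by rewrite sqr_sqrtr// divr_ge0 ?ltW.
pose M := m * s / (v + s ^+ 2).
have peakS : normal_peak S = S^-1 * normal_peak 1.
  rewrite /normal_peak expr1n mul1r -mulrnAr sqrtrM ?sqr_ge0// sqrtr_sqr.
  by rewrite ger0_norm ?sqrtr_ge0// invfM.
rewrite /Rintegral ge0_integral_normal_prob; last 2 first.
- apply/measurable_EFinP; apply: continuous_measurable_fun => z.
  apply: (continuous_comp (f := fun z => (s * z - m) / Num.sqrt v)).
    by apply: cvgMl; apply: cvgB; [apply: cvgMr; exact: cvg_id|exact: cvg_cst].
  exact: continuous_gbump.
- by move=> z; rewrite lee_fin gbump_ge0.
under eq_integral => z _.
  rewrite (_ : (_ * _)%E = ((S * c)%:E * (normal_pdf M S z)%:E)%E).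
    over.
  rewrite -!EFinM; congr EFin; rewrite !normal_pdfE ?oner_eq0// peakS.
  rewrite mulrCA (_ : S * c * _ = normal_peak 1 * (c * normal_fun M S z)); last first.
    by field.
  congr (_ * _); rewrite /c /gbump /normal_fun -!expRD; congr expR.
  rewrite expr_div_n sqr_sqrtr ?(ltW v0)// S2 /M expr1n.
  by field; rewrite !gt_eqF.
rewrite ge0_integralZl//.
- by rewrite integral_normal_pdf mule1.
- by apply/measurable_EFinP; exact: measurable_normal_pdf.
- by move=> z _; rewrite lee_fin normal_pdf_ge0.
- by rewrite lee_fin mulr_ge0 ?sqrtr_ge0 ?expR_ge0.
Qed.

End gaussian_bumps.

(** * The second moment method *)

Section second_moment.
Context d (T : measurableType d) (R : realType) (P : probability T R).

Lemma integrable_Rsum (I : Type) (s : seq I) (f : I -> T -> R) :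
  (forall i, P.-integrable setT (EFin \o f i)) ->
  P.-integrable setT (EFin \o (fun t => \sum_(i <- s) f i t)).
Proof.
move=> fi; rewrite (_ : _ \o _ = (fun t => \sum_(i <- s) (f i t)%:E)%E).
  by apply: integrable_sum => // i _; exact: fi.
by apply/funext => t /=; rewrite sumEFin.
Qed.

Lemma Rintegral_sum (I : Type) (s : seq I) (f : I -> T -> R) :
  (forall i, P.-integrable setT (EFin \o f i)) ->
  \int[P]_t (\sum_(i <- s) f i t) = \sum_(i <- s) \int[P]_t f i t.
Proof.
move=> fi; elim: s => [|i s ih].
  under eq_Rintegral do rewrite big_nil.
  by rewrite Rintegral_probability_cst big_nil.
under eq_Rintegral do rewrite big_cons.
rewrite (RintegralD measurableT (fi i) (integrable_Rsum s fi)).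
by rewrite ih big_cons.
Qed.

(* Chebyshev's inequality for [\sum_i f i], which on [A] is at most the small
   quantity [k * \sum_i g i]. *)
Lemma second_moment_bound (n : nat) (f g : 'I_n -> T -> R) (A : set T)
    (G H K k : R) :
  measurable A -> (0 < n)%N -> 0 < G -> 0 <= K -> 0 <= k ->
  (forall i, measurable_fun [set: T] (f i)) ->
  (forall i, measurable_fun [set: T] (g i)) ->
  (forall i t, 0 <= f i t <= 1) -> (forall i t, 0 <= g i t <= 1) ->
  (forall i, \int[P]_t f i t = G) -> (forall i, \int[P]_t g i t = H) ->
  (forall i j, i != j -> \int[P]_t (f i t * f j t) = K) ->
  (forall t, A t -> forall i, f i t <= k * g i t) ->
  fine (P A) <= 4 * ((n%:R * G)^-1 + K / G ^+ 2 - 1) + 2 * k * (H / G).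
Proof.
move=> mA n0 G0 K0 k0 mf mg f01 g01 fG gH fK fg.
have nR0 : 0 < n%:R :> R by rewrite ltr0n.
pose mu := n%:R * G; have mu0 : 0 < mu by rewrite mulr_gt0.
pose N t := \sum_(i <- enum 'I_n) f i t.
pose M t := \sum_(i <- enum 'I_n) g i t.
have if1 i : P.-integrable setT (EFin \o f i).
  apply: (@integrable_bounded _ _ _ _ 1 _ (mf i)) => t.
  by have /andP[h1 h2] := f01 i t; rewrite ger0_norm.
have ig1 i : P.-integrable setT (EFin \o g i).
  apply: (@integrable_bounded _ _ _ _ 1 _ (mg i)) => t.
  by have /andP[h1 h2] := g01 i t; rewrite ger0_norm.
have iff i j : P.-integrable setT (EFin \o (fun t => f i t * f j t)).
  apply: (@integrable_bounded _ _ _ _ 1); first exact: measurable_funM.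
  move=> t; have /andP[h1 h2] := f01 i t; have /andP[h3 h4] := f01 j t.
  by rewrite ger0_norm ?mulr_ge0// mulr_ile1.
have sumc (c : R) : \sum_(i <- enum 'I_n) c = n%:R * c.
  by rewrite big_enum/= sumr_const card_ord mulr_natl.
have EN : \int[P]_t N t = mu.
  by rewrite Rintegral_sum//; under eq_bigr do rewrite fG; rewrite sumc.
have EM : \int[P]_t M t = n%:R * H.
  by rewrite Rintegral_sum//; under eq_bigr do rewrite gH; rewrite sumc.
pose N2 t := \sum_(i <- enum 'I_n) \sum_(j <- enum 'I_n) f i t * f j t.
have iN2 : P.-integrable setT (EFin \o N2).
  by apply: integrable_Rsum => i; exact: integrable_Rsum.
(* On the diagonal [f i ^ 2 <= f i], because [f i <= 1]; off it there are at most [n ^ 2] pairs,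
   each contributing [K >= 0]. *)
have EN2 : \int[P]_t N2 t <= mu + n%:R ^+ 2 * K.
  rewrite Rintegral_sum; last by move=> i; exact: integrable_Rsum.
  rewrite -[leRHS](_ : \sum_(i <- enum 'I_n) (G + n%:R * K) = _); last first.
    by rewrite sumc mulrDr expr2 mulrA.
  apply: ler_sum => i _; rewrite Rintegral_sum//.
  rewrite big_enum/= (bigD1 i)//=; apply: lerD.
    rewrite -(fG i); apply: le_Rintegral => // t _.
    by have /andP[h1 h2] := f01 i t; rewrite ler_piMl.
  rewrite (eq_bigr (fun=> K)); last by move=> j ji; rewrite fK// eq_sym.
  apply: le_trans (_ : \sum_(j < n) K <= _); last first.
    by rewrite sumr_const card_ord mulr_natl.
  by rewrite [leRHS](bigD1 i)//= lerDr.
have N2E t : N2 t = N t ^+ 2.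
  rewrite expr2 /N mulr_suml; apply: eq_bigr => i _.
  by rewrite mulr_sumr.
(* [h] equals [4 * (1 - N / mu) ^ 2 + 2 * k * M / mu] and majorises the indicator of [A]: if
   [N <= mu / 2] the square term is at least 1; otherwise, on [A], [mu / 2 < N <= k * M] and the
   last term exceeds 1. *)
pose h t := 4 - 8 / mu * N t + 4 / mu ^+ 2 * N2 t + 2 * k / mu * M t.
have iN : P.-integrable setT (EFin \o N) by exact: integrable_Rsum.
have iM : P.-integrable setT (EFin \o M) by exact: integrable_Rsum.
have i4 : P.-integrable setT (EFin \o (fun=> 4 : R)).
  by apply: (@integrable_bounded _ _ _ _ 4) => // t; rewrite ger0_norm.
have ih1 : P.-integrable setT (EFin \o (fun t => 8 / mu * N t)).
  by apply: (integrableZl measurableT (8 / mu) iN).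
have ih2 : P.-integrable setT (EFin \o (fun t => 4 / mu ^+ 2 * N2 t)).
  by apply: (integrableZl measurableT (4 / mu ^+ 2) iN2).
have ih3 : P.-integrable setT (EFin \o (fun t => 2 * k / mu * M t)).
  by apply: (integrableZl measurableT (2 * k / mu) iM).
have ih12 : P.-integrable setT (EFin \o (fun t => 4 - 8 / mu * N t)).
  by apply: (integrableB measurableT i4 ih1).
have ih123 : P.-integrable setT
    (EFin \o (fun t => 4 - 8 / mu * N t + 4 / mu ^+ 2 * N2 t)).
  by apply: (integrableD measurableT ih12 ih2).
have ihh : P.-integrable setT (EFin \o h).
  by apply: (integrableD measurableT ih123 ih3).
have Eh : \int[P]_t h t = 4 - 8 / mu * mu + 4 / mu ^+ 2 * (\int[P]_t N2 t) +
    2 * k / mu * (n%:R * H).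
  rewrite /h RintegralD// RintegralD// RintegralB// !RintegralZl//.
  by rewrite EN EM Rintegral_probability_cst.
have -> : fine (P A) = \int[P]_t \1_A t.
  by rewrite /Rintegral integral_indic// setIT.
apply: (@le_trans _ _ (\int[P]_t h t)).
  apply: le_Rintegral => //.
    apply: (@integrable_bounded _ _ _ _ 1); first exact: measurable_indic.
    by move=> t; rewrite indicE; case: (t \in A); rewrite ?normr1 ?normr0.
  move=> t _; rewrite indicE /h N2E.
  have M0 : 0 <= M t by apply: sumr_ge0 => i _; have /andP[] := g01 i t.
  have -> : 4 - 8 / mu * N t + 4 / mu ^+ 2 * N t ^+ 2 + 2 * k / mu * M t =
      4 * (1 - N t / mu) ^+ 2 + 2 * (k * M t / mu).
    by field; rewrite gt_eqF.
  have r0 : 0 <= k * M t / mu by rewrite divr_ge0 ?mulr_ge0// ltW.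
  have [tA|_] := boolP (t \in A); last first.
    by rewrite mulr0n; apply: addr_ge0; apply: mulr_ge0 => //; exact: sqr_ge0.
  rewrite mulr1n.
  have NM : N t / mu <= k * M t / mu.
    rewrite ler_pM2r ?invr_gt0// /N /M mulr_sumr; apply: ler_sum => i _.
    by apply: fg; rewrite inE in tA.
  have := sqr_ge0 (1 - N t / mu).
  case: (lerP (N t / mu) (1 / 2)) => hN; last by lra.
  set x := N t / mu in hN NM *; rewrite sqrrB; nra.
rewrite Eh (_ : 8 / mu * mu = 8); last by rewrite divfK// gt_eqF.
have -> : 2 * k / mu * (n%:R * H) = 2 * k * (H / G).
  by rewrite /mu; field; rewrite !gt_eqF.
rewrite lerD2r.
have -> : 4 * ((n%:R * G)^-1 + K / G ^+ 2 - 1) =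
    4 - 8 + 4 / mu ^+ 2 * (mu + n%:R ^+ 2 * K).
  by rewrite /mu; field; rewrite !gt_eqF.
by rewrite lerD2l ler_wpM2l// divr_ge0 ?sqr_ge0.
Qed.

End second_moment.

(** * Explicit estimates for the bump moments *)

Lemma sqrtr_le (R : rcfType) (x y : R) : 0 <= y -> x <= y ^+ 2 -> Num.sqrt x <= y.
Proof. by move=> y0 xy; rewrite -(ger0_norm y0) -sqrtr_sqr ler_wsqrtr. Qed.

Lemma le_sqrtr (R : rcfType) (x y : R) : 0 <= x -> x ^+ 2 <= y -> x <= Num.sqrt y.
Proof. by move=> x0 xy; rewrite -(ger0_norm x0) -sqrtr_sqr ler_wsqrtr. Qed.

Lemma expR_ge_sqr (R : realType) (x : R) : 0 <= x -> 1 + x ^+ 2 / 2 <= expR x.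
Proof. by move=> x0; have := expR_ge1Dxn 1 x0. Qed.

Section bump_estimates.
Context {R : realType}.
Implicit Types w z eps : R.

(* With [w = 1 / n], the bump is centred at [a] and has squared width [v]; then
   [q = v + (1 - w)] is that width plus the variance [1 - w] of the [V_i]. The
   three quantities below are [E f (V_i)], the same for a bump of squared width
   [2 v], and [E f (V_i) f (V_j)]. *)
Local Notation u z := (z ^- 2).
Local Notation v w z := (w + u z).
Local Notation a z eps := (z - eps).
Local Notation q z := (1 + u z).

Definition bump_mean w z eps :=
  Num.sqrt (v w z / q z) * expR (- (a z eps ^+ 2 / (2 * q z))).

Definition bump_mean_wide w z eps :=
  Num.sqrt (2 * v w z / (q z + v w z)) *
  expR (- (a z eps ^+ 2 / (2 * (q z + v w z)))).

Definition bump_pair w z eps :=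
  Num.sqrt (v w z / (q z + w)) * Num.sqrt (v w z / (q z - w)) *
  expR (- (a z eps ^+ 2 / (q z - w))).

Lemma bump_mean_gt0 w z eps : 0 < w -> 4 <= z -> 0 < bump_mean w z eps.
Proof.
move=> w0 z4; have u0 : 0 < z ^- 2 by rewrite invr_gt0 exprn_gt0; lra.
by rewrite mulr_gt0 ?expR_gt0// sqrtr_gt0 divr_gt0// addr_gt0.
Qed.

Lemma invr_sqr_bounds z : 4 <= z ->
  [/\ 0 < z ^- 2, z ^- 2 * z ^+ 2 = 1 & z ^- 2 <= 1 / 16].
Proof.
move=> z4; have z0 : 0 < z by lra.
have u0 : 0 < z ^- 2 by rewrite invr_gt0 exprn_gt0.
have uz : z ^- 2 * z ^+ 2 = 1 by rewrite mulVf// gt_eqF// exprn_gt0.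
split => //; have h : 16 <= z ^+ 2 by nra.
have : z ^- 2 * 16 <= z ^- 2 * z ^+ 2 by rewrite ler_wpM2l// ltW.
by rewrite uz; lra.
Qed.

(** The negative covariance replaces [q] by [q - w] in the exponent, which only lowers the
    exponential. What remains is the ratio of prefactors [q / sqrt (q ^ 2 - w ^ 2)], controlled
    through [1 <= q]. *)
Lemma bump_pair_le w z eps : 0 < w -> w <= 1 / 2 -> 4 <= z ->
  bump_pair w z eps / bump_mean w z eps ^+ 2 <= 1 / (1 - w ^+ 2).
Proof.
move=> w0 w2 z4; have [u0 _ _] := invr_sqr_bounds z4.
rewrite ler_pdivrMr ?exprn_gt0 ?bump_mean_gt0//.
rewrite /bump_pair /bump_mean; move: (z ^- 2) u0 => u u0.
set a := z - eps; set v := w + u; set q := 1 + u.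
have q1 : 1 <= q by rewrite lerDl ltW.
have v0 : 0 < v by rewrite addr_gt0.
have q0 : 0 < q by lra.
have G2 : (Num.sqrt (v / q) * expR (- (a ^+ 2 / (2 * q)))) ^+ 2 =
    v / q * expR (- (a ^+ 2 / q)).
  rewrite exprMn sqr_sqrtr; last by rewrite divr_ge0 ?ltW.
  by rewrite -expRM_natl; congr (_ * expR _); field; rewrite gt_eqF.
rewrite G2; have qw : 0 < q - w by lra.
have qw' : 0 < q + w by lra.
clearbody q v a.
have h1 : expR (- (a ^+ 2 / (q - w))) <= expR (- (a ^+ 2 / q)).
  rewrite ler_expR lerN2 ler_wpM2l ?sqr_ge0// lef_pV2 ?posrE//; lra.
have h2 : Num.sqrt (v / (q + w)) * Num.sqrt (v / (q - w)) <= 1 / (1 - w ^+ 2) * (v / q).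
  rewrite -sqrtrM; last by rewrite divr_ge0 ?ltW.
  have w21 : 0 < 1 - w ^+ 2 by nra.
  apply: sqrtr_le; first by rewrite !mulr_ge0 ?invr_ge0 ?ltW.
  rewrite -subr_ge0 (_ : _ - _ = v ^+ 2 *
     ((q ^+ 2 - w ^+ 2) - q ^+ 2 * (1 - w ^+ 2) ^+ 2) /
     ((q + w) * (q - w) * q ^+ 2 * (1 - w ^+ 2) ^+ 2)); last first.
    by field; rewrite !gt_eqF.
  rewrite divr_ge0//; last by rewrite !mulr_ge0 ?sqr_ge0 ?ltW.
  rewrite mulr_ge0 ?sqr_ge0//.
  have q2 : 1 <= q ^+ 2 by rewrite exprn_ege1.
  have w20 : 0 <= w ^+ 2 by rewrite sqr_ge0.
  have w21' : w ^+ 2 <= 1 / 4 by nra.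
  rewrite (_ : _ - _ = w ^+ 2 * (q ^+ 2 * (2 - w ^+ 2) - 1)); last by ring.
  by rewrite mulr_ge0//; nra.
by rewrite [leRHS]mulrA; apply: ler_pM.
Qed.

(** The prefactor of [bump_mean] costs at most a factor [1 / (2 * z)]. Lowering the centre by [eps]
    gains [exp (eps * z / 2)], of which the quadratic term is kept so that a factor [z] survives. *)
Lemma bump_mean_lower w z eps : 0 < w -> w <= 1 / 2 -> 4 <= z -> 0 < eps ->
  eps <= z -> w * expR (z ^+ 2 / 2) <= 1 ->
  (w^-1 * bump_mean w z eps)^-1 <= 16 / (eps ^+ 2 * z).
Proof.
move=> w0 w2 z4 e0 ez wz; have [u0 uz u1] := invr_sqr_bounds z4.
have z0 : 0 < z by lra.
have G0 := bump_mean_gt0 eps w0 z4.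
have s1 : 1 / (2 * z) <= Num.sqrt ((w + z ^- 2) / (1 + z ^- 2)).
  apply: le_sqrtr; first by rewrite divr_ge0 ?mulr_ge0 ?ltW.
  rewrite (_ : _ ^+ 2 = z ^- 2 / 4); last by field; rewrite gt_eqF.
  move: (z ^- 2) u0 u1 => u u0 u1.
  rewrite ler_pdivlMr; [nra|lra].
have s2 : expR (- ((z - eps) ^+ 2 / 2)) <= expR (- ((z - eps) ^+ 2 / (2 * (1 + z ^- 2)))).
  rewrite ler_expR lerN2 ler_wpM2l ?sqr_ge0// lef_pV2 ?posrE//; lra.
have s3 : expR (z ^+ 2 / 2) <= w^-1 by rewrite -[leRHS]mul1r ler_pdivlMr// mulrC.
have s4 : eps ^+ 2 * z ^+ 2 / 8 <= expR (z ^+ 2 / 2) * expR (- ((z - eps) ^+ 2 / 2)).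
  rewrite -expRD; have x0 : 0 <= eps * z / 2 by rewrite divr_ge0 ?mulr_ge0 ?ltW.
  apply: (@le_trans _ _ (expR (eps * z / 2))).
    by have := expR_ge_sqr x0; lra.
  by rewrite ler_expR; nra.
have lo : eps ^+ 2 * z / 16 <= w^-1 * bump_mean w z eps.
  apply: (@le_trans _ _ (expR (z ^+ 2 / 2) *
      (1 / (2 * z) * expR (- ((z - eps) ^+ 2 / 2))))).
    rewrite mulrCA (_ : _ / 16 = 1 / (2 * z) * (eps ^+ 2 * z ^+ 2 / 8)); last first.
      by field; rewrite gt_eqF.
    by rewrite ler_wpM2l// divr_ge0// mulr_ge0 ?ltW.
  have c0 : 0 <= 1 / (2 * z) by rewrite divr_ge0// mulr_ge0 ?ltW.
  have c1 : 1 / (2 * z) * expR (- ((z - eps) ^+ 2 / 2)) <= bump_mean w z eps.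
    by apply: ler_pM.
  by apply: ler_pM => //; rewrite mulr_ge0 ?expR_ge0.
rewrite -[leRHS]invrK lef_pV2 ?posrE; last 2 first.
- by rewrite mulr_gt0 ?invr_gt0.
- by rewrite invr_gt0 divr_gt0// mulr_gt0// exprn_gt0.
by rewrite invf_div.
Qed.

(** Everything rests on [v * z ^ 2 <= 2] for the squared width [v]. Doubling [v] then raises the
    exponent by at most 1 and the prefactor by at most 2, whence [2 * expR 1]; and
    [exp (- x) <= 1 / x] bounds the first factor by [4 * v / eps ^ 2 <= 8 / (eps ^ 2 * z ^ 2)]. *)
Lemma bump_wide_le w z eps : 0 < w -> w <= 1 / 2 -> 4 <= z -> 0 < eps ->
  eps <= z -> w * expR (z ^+ 2 / 2) <= 1 ->
  expR (- (eps ^+ 2 / (4 * (w + z ^- 2)))) *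
    (bump_mean_wide w z eps / bump_mean w z eps) <=
  16 * expR 1 / (eps ^+ 2 * z ^+ 2).
Proof.
move=> w0 w2 z4 e0 ez wz; have [u0 uz u1] := invr_sqr_bounds z4.
have z0 : 0 < z by lra.
have G0 := bump_mean_gt0 eps w0 z4.
have wz2 : w * z ^+ 2 <= 1.
  have x0 : 0 <= z ^+ 2 / 2 by rewrite divr_ge0 ?sqr_ge0.
  apply: le_trans wz; rewrite ler_pM2l//; apply: le_trans (expR_ge_sqr x0).
  have : 16 <= z ^+ 2 by nra.
  nra.
have vz2 : (w + z ^- 2) * z ^+ 2 <= 2 by rewrite mulrDl uz; lra.
have G20 : 0 <= bump_mean_wide w z eps by rewrite mulr_ge0 ?sqrtr_ge0 ?expR_ge0.
have h1 : bump_mean_wide w z eps / bump_mean w z eps <= 2 * expR 1.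
  rewrite ler_pdivrMr// /bump_mean_wide /bump_mean.
  have v0 : 0 < w + z ^- 2 by rewrite addr_gt0.
  have q1 : 1 <= 1 + z ^- 2 by lra.
  move: (w + z ^- 2) (1 + z ^- 2) vz2 v0 q1 => v q vz2 v0 q1.
  have q0 : 0 < q by lra.
  have qv : 0 < q + v by lra.
  have s1 : Num.sqrt (2 * v / (q + v)) <= 2 * Num.sqrt (v / q).
    apply: sqrtr_le; first by rewrite mulr_ge0 ?sqrtr_ge0.
    rewrite exprMn sqr_sqrtr; last by rewrite divr_ge0 ?ltW.
    rewrite -subr_ge0 (_ : _ - _ = v * (2 * q + 4 * v) / (q * (q + v))); last first.
      by field; rewrite !gt_eqF.
    by rewrite divr_ge0 ?mulr_ge0 ?addr_ge0 ?mulr_ge0 ?ltW.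
  have s2 : expR (- ((z - eps) ^+ 2 / (2 * (q + v)))) <=
      expR 1 * expR (- ((z - eps) ^+ 2 / (2 * q))).
    rewrite -expRD ler_expR -subr_ge0.
    rewrite (_ : _ - _ = 1 - (z - eps) ^+ 2 * v / (2 * q * (q + v))); last first.
      by field; rewrite !gt_eqF.
    rewrite subr_ge0 ler_pdivrMr ?mulr_gt0// mul1r.
    have a2 : (z - eps) ^+ 2 <= z ^+ 2 by nra.
    have : (z - eps) ^+ 2 * v <= z ^+ 2 * v by rewrite ler_wpM2r// ltW.
    have : 1 <= q * (q + v) by nra.
    lra.
  apply: (le_trans (ler_pM _ _ s1 s2)); rewrite ?sqrtr_ge0 ?expR_ge0//.
  by rewrite le_eqVlt; apply/orP; left; apply/eqP; ring.
have h2 : expR (- (eps ^+ 2 / (4 * (w + z ^- 2)))) <= 8 / (eps ^+ 2 * z ^+ 2).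
  have v0 : 0 < w + z ^- 2 by rewrite addr_gt0.
  move: (w + z ^- 2) vz2 v0 => v vz2 v0.
  rewrite expRN -[leRHS]invrK lef_pV2 ?posrE ?expR_gt0//; last first.
    by rewrite invr_gt0 divr_gt0// mulr_gt0// exprn_gt0.
  apply: (@le_trans _ _ (eps ^+ 2 / (4 * v))); last first.
    by have := expR_ge1Dx (eps ^+ 2 / (4 * v)); lra.
  rewrite invf_div -subr_ge0.
  rewrite (_ : _ - _ = eps ^+ 2 * (2 - v * z ^+ 2) / (8 * v)); last first.
    by field; rewrite gt_eqF.
  apply: divr_ge0; last by lra.
  by rewrite mulr_ge0 ?sqr_ge0 ?subr_ge0.
apply: (le_trans (ler_pM _ _ h2 h1)); rewrite ?expR_ge0 ?divr_ge0 ?(ltW G0)//.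
by rewrite le_eqVlt; apply/orP; left; apply/eqP; field; rewrite !gt_eqF.
Qed.

End bump_estimates.

(** * The normal distribution function *)

Section normal_cdf.
Context {R : realType}.
Local Notation mu := (@lebesgue_measure R).
Local Notation stdn := (@normal_prob R 0 1).
Implicit Types x y z h : R.

Lemma EFin_Phi x : (Phi x)%:E = stdn `]-oo, x]%classic.
Proof. by rewrite /Phi fineK// fin_num_measure. Qed.

Lemma Phi_tail x : stdn `]x, +oo[%classic = (1 - Phi x)%:E.
Proof.
have -> : `]x, +oo[%classic = ~` `]-oo, x]%classic :> set R by rewrite setCitvl.
by rewrite [LHS]probability_setC// EFinB EFin_Phi.
Qed.

Lemma Phi_itv x y : x <= y -> (Phi y - Phi x)%:E = stdn `]x, y]%classic.
Proof.
move=> xy; rewrite EFinB !EFin_Phi.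
have -> : `]-oo, y]%classic = `]-oo, x]%classic `|` `]x, y]%classic :> set R.
  by rewrite -itv_bndbnd_setU// bnd_simp.
rewrite [X in (X - _)%E]measureU//; last first.
  apply/seteqP; split=> t //=; rewrite !in_itv/= => -[tx /andP[xt _]].
  by move: tx; rewrite leNgt xt.
by rewrite addeAC subee ?add0e// fin_num_measure.
Qed.

Lemma Phi_nondecreasing x y : x <= y -> Phi x <= Phi y.
Proof.
by move=> xy; rewrite -subr_ge0 -lee_fin Phi_itv.
Qed.

Lemma Phi_lipschitz x y : `|Phi x - Phi y| <= normal_peak 1 * `|x - y|.
Proof.
wlog xy : x y / x <= y.
  move=> H; have [xy|/ltW yx] := leP x y; first exact: H.
  by rewrite distrC (distrC x); exact: H.
rewrite distrC (distrC x) !ger0_norm ?subr_ge0 ?Phi_nondecreasing//.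
rewrite -lee_fin Phi_itv// /normal_prob.
apply: (@le_trans _ _ (\int[mu]_(t in `]x, y]) (normal_peak 1)%:E)%E).
  apply: ge0_le_integral => //.
  - by move=> t _; rewrite lee_fin normal_pdf_ge0.
  - by apply/measurable_EFinP; apply: measurable_funTS; exact: measurable_normal_pdf.
  - by move=> t _; rewrite lee_fin normal_pdf_ub ?oner_eq0.
rewrite integral_cst//= lebesgue_measure_itv/= lte_fin; case: ltP => // _.
by rewrite mule0 lee_fin mulr_ge0 ?normal_peak_ge0 ?subr_ge0.
Qed.

Lemma continuous_Phi : continuous (@Phi R).
Proof.
have p0 : 0 < normal_peak 1 :> R by rewrite normal_peak_gt0 ?oner_eq0.
move=> x; apply/cvgrPdist_le => /= e e0; near=> y.
apply: (le_trans (Phi_lipschitz _ _)).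
rewrite mulrC -ler_pdivlMr//.
near: y; apply: (filterS _ (nbhsx_ballx x _ (divr_gt0 e0 p0))) => y.
by move=> /ltW.
Unshelve. all: by end_near. Qed.

(* The tail beyond [z + h] is the tail beyond [z] of the law N(-h, 1), whose
   density is [expR (- h x - h ^ 2 / 2)] times the standard one. *)
Lemma Phi_tail_shift z h : 0 <= h ->
  1 - Phi (z + h) <= expR (- (h * z + h ^+ 2 / 2)) * (1 - Phi z).
Proof.
move=> h0; rewrite -lee_fin EFinM -!Phi_tail.
have shiftE : (fun x : R => 1 * x + - h) @^-1` `]z, +oo[%classic =
    `]z + h, +oo[%classic :> set R.
  by apply/seteqP; split=> x /=; rewrite !in_itv/= !andbT mul1r ltrBrDr.
rewrite -shiftE -normal_prob_affine//.
rewrite /normal_prob -ge0_integralZl//; last 2 first.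
- by apply/measurable_EFinP; apply: measurable_funTS; exact: measurable_normal_pdf.
- by move=> t _; rewrite lee_fin normal_pdf_ge0.
apply: ge0_le_integral => //.
- by move=> t _; rewrite lee_fin normal_pdf_ge0.
- by apply/measurable_EFinP; apply: measurable_funTS; exact: measurable_normal_pdf.
- apply/measurable_EFinP; apply: measurable_funTS; apply: measurable_funM => //.
  exact: measurable_normal_pdf.
move=> x; rewrite /= in_itv/= andbT => zx.
rewrite lee_fin !normal_pdfE ?oner_eq0// mulrCA ler_wpM2l ?normal_peak_ge0//.
rewrite /normal_fun -expRD ler_expR expr1n subr0 opprK.
have : h * z <= h * x by rewrite ler_wpM2l// ltW.
lra.
Qed.

Lemma Phi_ge0 x : 0 <= Phi x. Proof. by rewrite fine_ge0. Qed.

Lemma Phi_tail_chernoff z : 0 <= z -> 1 - Phi z <= expR (- (z ^+ 2 / 2)).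
Proof.
move=> z0; have := Phi_tail_shift 0 z0; rewrite add0r mulr0 add0r.
move=> /le_trans; apply; rewrite ler_piMr ?expR_ge0//.
by have := Phi_ge0 0; lra.
Qed.

Lemma Phi_lt1 x : Phi x < 1.
Proof.
rewrite -subr_gt0 -lte_fin -Phi_tail.
(* [c] is the density at [|x| + 1], which bounds [|t|] on []x, x + 1]]; this unit interval therefore
   has mass at least [c]. *)
pose c : R := normal_peak 1 * expR (- ((`|x| + 1) ^+ 2 / 2)).
apply: (@lt_le_trans _ _ (\int[mu]_(t in `]x, (x + 1)%R]) c%:E)%E).
  rewrite integral_cst//= lebesgue_measure_itv/= lte_fin ltrDl ltr01.
  rewrite -EFinB -EFinM lte_fin addrAC subrr add0r mulr1 mulr_gt0 ?expR_gt0//.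
  by rewrite normal_peak_gt0 ?oner_eq0.
apply: (@le_trans _ _ (stdn `]x, (x + 1)]%classic)); last first.
  by apply: le_measure; rewrite ?inE//; apply: subset_itvl; rewrite bnd_simp.
apply: ge0_le_integral => //.
- by move=> t _; rewrite lee_fin mulr_ge0 ?normal_peak_ge0 ?expR_ge0.
- by apply/measurable_EFinP; apply: measurable_funTS; exact: measurable_normal_pdf.
move=> t; rewrite /= in_itv/= => /andP[xt tx].
rewrite lee_fin normal_pdfE ?oner_eq0// ler_wpM2l ?normal_peak_ge0//.
rewrite /normal_fun ler_expR expr1n subr0 mulNr lerN2 ler_pM2r//.
rewrite -[leLHS]real_normK ?num_real// ler_sqr ?nnegrE ?addr_ge0//.
rewrite ler_norml; have := ler_norm x; have := ler_norm (- x).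
by rewrite normrN => h1 h2; apply/andP; split; lra.
Qed.

Lemma Phi_surjective (p : R) : 0 < p < 1 -> exists x, Phi x = p.
Proof.
move=> /andP[p0 p1].
(* As the distribution function of the identity variable, [Phi] has limits 0 and 1; the intermediate
   value theorem does the rest. *)
pose X : {RV stdn >-> R} := @mfun_Sub _ _ (measurableTypeR R) R _
  (mem_set (@measurable_id _ (measurableTypeR R) setT)).
have cN : Phi x @[x --> -oo] --> (0 : R) by exact/fine_cvg/(cvg_cdfNy0 X).
have cy : Phi x @[x --> +oo] --> (1 : R) by exact/fine_cvg/(cvg_cdfy1 X).
have [a aP] : exists a, Phi a <= p.
  have : \forall x \near -oo, Phi x <= p.
    by apply: (cvgr_le _ cN); rewrite ?p0.
  by move=> /filter_ex.
have [b bP] : exists b, p <= Phi b.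
  have : \forall x \near +oo, p <= Phi x.
    by apply: (cvgr_ge _ cy).
  by move=> /filter_ex.
have [ab|/ltW ba] := leP a b; last first.
  by exists a; apply/eqP; rewrite eq_le aP (le_trans bP)// Phi_nondecreasing.
have [||c _ <-] := @IVT R (@Phi R) a b p ab; last by exists c.
  by apply: continuous_subspaceT; exact: continuous_Phi.
by rewrite ge_min le_max aP bP orbT.
Qed.

Lemma Phi_invK (p : R) : 0 < p < 1 -> Phi (Phi_inv p) = p.
Proof. by move=> /Phi_surjective[x xp]; rewrite /Phi_inv; case: xgetP => [y _ ->//|/(_ x)]. Qed.

(** Each [Phi A] is less than 1, hence is eventually overtaken by [1 - 1 / n]. *)
Lemma cvg_Phi_inv_oneBV :
  Phi_inv (1 - n%:R^-1 : R) @[n --> \oo] --> +oo.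
Proof.
apply/cvgryPge => A; near=> n.
have n1 : (1 < n)%N by near: n; exact: nbhs_infty_gt.
have n0 : 0 < n%:R :> R by rewrite ltr0n (ltn_trans _ n1).
rewrite leNgt; apply/negP => /ltW /Phi_nondecreasing.
rewrite Phi_invK; last first.
  by rewrite subr_gt0 invf_lt1// ltr1n n1/= ltrBlDr ltrDl invr_gt0.
apply/negP; rewrite -ltNge ltrBrDl -ltrBrDr -[ltRHS]invrK.
rewrite ltf_pV2 ?posrE ?invr_gt0 ?subr_gt0 ?Phi_lt1//.
near: n; exact: nbhs_infty_gtr.
Unshelve. all: by end_near. Qed.

End normal_cdf.

(** * Bump integrals of Gaussian variables and pairs *)

Lemma Rintegral_normal_law_gbump d (T : measurableType d) (R : realType)
    (P : probability T R) (Y : T -> R) (s m v : R) :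
  measurable_fun [set: T] Y -> normal_law P Y 0 s -> 0 < v ->
  \int[P]_t gbump ((Y t - m) / Num.sqrt v) =
  Num.sqrt (v / (v + s ^+ 2)) * expR (- (m ^+ 2 / (2 * (v + s ^+ 2)))).
Proof.
move=> mY lY v0.
have cg : continuous (fun y : R => gbump ((y - m) / Num.sqrt v)).
  move=> y; apply: (continuous_comp (f := fun y => (y - m) / Num.sqrt v)).
    by apply: cvgMl; apply: cvgB; [exact: cvg_id|exact: cvg_cst].
  exact: continuous_gbump.
have mg : measurable_fun [set: R] (fun y : R => gbump ((y - m) / Num.sqrt v)).
  exact: continuous_measurable_fun.
rewrite (Rintegral_normal_law mY lY mg).
  by under eq_Rintegral do rewrite addr0; exact: stdn_gbump.
apply: (@integrable_stdn_bounded _ 1); last by move=> z; exact: normr_gbump.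
by apply: (measurableT_comp mg); exact: measurable_affine.
Qed.

Lemma mul_cos (R : realType) (x y : R) :
  cos x * cos y = 1 / 2 * (cos (x + y) + cos (x - y)).
Proof. by rewrite cosD cosB; field. Qed.

Section gaussian_pair.
Context d (T : measurableType d) (R : realType) (P : probability T R).
Variables (D S : T -> R) (A B : R).
Hypotheses (mD : measurable_fun [set: T] D) (mS : measurable_fun [set: T] S)
  (A0 : 0 <= A) (B0 : 0 <= B)
  (lDS : forall t s : R, normal_law P (fun w => t * D w + s * S w) 0
    (Num.sqrt (t ^+ 2 * A + s ^+ 2 * B))).

Let cosDS (t s c : R) : \int[P]_w cos (t * D w + s * S w + c) =
  cos c * expR (- ((t ^+ 2 * A + s ^+ 2 * B) / 2)).
Proof.
rewrite (Rintegral_normal_law_cos _ _ (lDS t s)).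
  by rewrite sqr_sqrtr// addr_ge0// mulr_ge0 ?sqr_ge0.
by apply: measurable_funD; apply: measurable_funM.
Qed.

Let integrable_cos (Y : T -> R) : measurable_fun [set: T] Y ->
  P.-integrable setT (EFin \o (fun t => cos (Y t))).
Proof.
move=> mY; apply: (@integrable_bounded _ _ _ _ 1); last by move=> t; exact: cos_max.
exact: measurable_cos_comp.
Qed.

(** A product of cosines is half the sum of the cosines for [(t, s)] and [(t, - s)]. Both
    combinations have variance [t ^ 2 * A + s ^ 2 * B], which has no cross term, so the
    characteristic function factors as [gbump_independent] requires. *)
Lemma gaussian_pair_gbump (m v : R) : 0 < v ->
  \int[P]_w (gbump (D w / Num.sqrt v) * gbump ((S w - m) / Num.sqrt v)) =
  Num.sqrt (v / (v + A)) *
    (Num.sqrt (v / (v + B)) * expR (- (m ^+ 2 / (2 * (v + B))))).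
Proof.
move=> v0.
have mDv : measurable_fun [set: T] (fun w => D w / Num.sqrt v).
  exact: measurable_funM.
have mSv : measurable_fun [set: T] (fun w => (S w - m) / Num.sqrt v).
  by apply: measurable_funM => //; exact: measurable_funB.
rewrite gbump_independent//; last first.
  move=> x y; pose t := x / Num.sqrt v; pose s := y / Num.sqrt v.
  have E1 w : cos (x * (D w / Num.sqrt v)) = cos (t * D w + 0 * S w + 0).
    by congr cos; rewrite /t; ring.
  have E2 w : cos (y * ((S w - m) / Num.sqrt v)) = cos (0 * D w + s * S w + - (s * m)).
    by congr cos; rewrite /s; ring.
  under [X in _ = X * _]eq_Rintegral do rewrite E1.
  under [X in _ = _ * X]eq_Rintegral do rewrite E2.
  under eq_Rintegral do rewrite E1 E2 mul_cos.
  have mlin (p q c : R) : measurable_fun [set: T] (fun w => p * D w + q * S w + c).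
    by apply: measurable_funD => //; apply: measurable_funD; apply: measurable_funM.
  have i1 : P.-integrable setT (EFin \o (fun w =>
      cos (t * D w + 0 * S w + 0 + (0 * D w + s * S w + - (s * m))))).
    by apply: integrable_cos; apply: measurable_funD; exact: mlin.
  have i2 : P.-integrable setT (EFin \o (fun w =>
      cos (t * D w + 0 * S w + 0 - (0 * D w + s * S w + - (s * m))))).
    by apply: integrable_cos; apply: measurable_funB; exact: mlin.
  rewrite (RintegralZl _ measurableT (integrableD measurableT i1 i2)).
  rewrite (RintegralD measurableT i1 i2).
  have E3 w : t * D w + 0 * S w + 0 + (0 * D w + s * S w + - (s * m)) =
    t * D w + s * S w + - (s * m) by ring.
  have E4 w : t * D w + 0 * S w + 0 - (0 * D w + s * S w + - (s * m)) =
    t * D w + (- s) * S w + s * m by ring.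
  under [X in _ * (X + _)]eq_Rintegral do rewrite E3.
  under [X in _ * (_ + X)]eq_Rintegral do rewrite E4.
  rewrite !cosDS cosN cos0 mul1r sqrrN !expr0n/= !mul0r addr0 add0r.
  rewrite (_ : _ / 2 = t ^+ 2 * A / 2 + s ^+ 2 * B / 2); last by field.
  by rewrite opprD expRD; field.
have lD : normal_law P D 0 (Num.sqrt A).
  have := lDS 1 0; rewrite expr1n expr0n mul1r mul0r addr0.
  by under eq_fun do rewrite mul1r mul0r addr0.
have lS : normal_law P S 0 (Num.sqrt B).
  have := lDS 0 1; rewrite expr1n expr0n mul1r mul0r add0r.
  by under eq_fun do rewrite mul1r mul0r add0r.
congr (_ * _); last by rewrite (Rintegral_normal_law_gbump _ mS lS v0) sqr_sqrtr.
under eq_Rintegral do rewrite -[D _]subr0.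
rewrite (Rintegral_normal_law_gbump _ mD lD v0) sqr_sqrtr//.
by rewrite expr0n/= mul0r oppr0 expR0 mulr1.
Qed.

End gaussian_pair.

(** * Lower tail of the maximum *)

Section max_lower.
Context d (T : measurableType d) (R : realType) (P : probability T R).

(** Variances [1 - 1 / n] and covariances [- 1 / n] make [V_i - V_j] and [V_i + V_j] uncorrelated,
    with variances [2] and [2 * (1 - 2 / n)]. The bumps are centred at [z - eps], and the event
    keeps every [V_i] a further [eps] below, whence [2 * eps]. *)
Lemma all_small_probability (n : nat) (V : 'I_n -> T -> R) (z eps : R) :
  (2 <= n)%N -> 4 <= z -> 0 < eps -> eps <= z ->
  n%:R^-1 * expR (z ^+ 2 / 2) <= 1 ->
  (forall i, measurable_fun [set: T] (V i)) ->
  (forall i, normal_law P (V i) 0 (Num.sqrt (1 - n%:R^-1))) ->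
  (forall i j, i != j -> forall t s : R,
    normal_law P (fun w => t * (V i w - V j w) + s * (V i w + V j w)) 0
      (Num.sqrt (t ^+ 2 * 2 + s ^+ 2 * (2 * (1 - 2 * n%:R^-1))))) ->
  fine (P [set w | forall i, V i w <= z - 2 * eps]) <=
  64 / (eps ^+ 2 * z) + 4 / n%:R + 32 * expR 1 / (eps ^+ 2 * z ^+ 2).
Proof.
move=> n2 z4 e0 ez nz mV lV lVV.
have nR0 : 0 < n%:R :> R by rewrite ltr0n (leq_trans _ n2).
set w : R := n%:R^-1 in nz lV lVV *.
have w0 : 0 < w by rewrite invr_gt0.
have w2 : w <= 1 / 2.
  by rewrite div1r lef_pV2 ?posrE// ler_nat.
have [u0 _ _] := invr_sqr_bounds z4.
pose v := w + z ^- 2; have v0 : 0 < v by rewrite addr_gt0.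
have v20 : 0 < 2 * v by rewrite mulr_gt0.
pose a := z - eps.
have mA : measurable [set t | forall i, V i t <= z - 2 * eps].
  rewrite (_ : [set _ | _] = \bigcap_(i in [set: 'I_n]) (V i @^-1` `]-oo, z - 2 * eps]%classic)).
    apply: fin_bigcap_measurable => // i _.
    by rewrite -[_ @^-1` _]setTI; exact: mV.
  apply/seteqP; split=> t /= Vt i; first by move=> _; rewrite /= in_itv/=.
  by have := Vt i I; rewrite /= in_itv/=.
have mb (s : R) i : measurable_fun [set: T] (fun t => gbump ((V i t - a) / s)).
  by apply: measurable_gbump; apply: measurable_funM => //; exact: measurable_funB.
have ga1 (s : R) i t : 0 <= gbump ((V i t - a) / s) <= 1.
  by rewrite gbump_ge0 gbump_le1.
have w1 : 0 <= 1 - w by lra.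
have w12 : 0 <= 2 * (1 - 2 * w) by lra.
have G0 := bump_mean_gt0 eps w0 z4.
have K0 : 0 <= bump_pair w z eps by rewrite !mulr_ge0 ?sqrtr_ge0 ?expR_ge0.
have fG i : \int[P]_t gbump ((V i t - a) / Num.sqrt v) = bump_mean w z eps.
  rewrite (Rintegral_normal_law_gbump _ (mV i) (lV i) v0) sqr_sqrtr//.
  by rewrite (_ : v + (1 - w) = 1 + z ^- 2)// /v; ring.
have gH i : \int[P]_t gbump ((V i t - a) / Num.sqrt (2 * v)) =
    bump_mean_wide w z eps.
  rewrite (Rintegral_normal_law_gbump _ (mV i) (lV i) v20) sqr_sqrtr//.
  by rewrite (_ : 2 * v + (1 - w) = 1 + z ^- 2 + v)// /v; ring.
(* (x - a)^2 + (y - a)^2 = ((x - y)^2 + (x + y - 2 a)^2) / 2 *)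
have fK i j : i != j -> \int[P]_t (gbump ((V i t - a) / Num.sqrt v) *
    gbump ((V j t - a) / Num.sqrt v)) = bump_pair w z eps.
  move=> ij; under eq_Rintegral => t _.
    rewrite (_ : _ * _ = gbump ((V i t - V j t) / Num.sqrt (2 * v)) *
      gbump ((V i t + V j t - 2 * a) / Num.sqrt (2 * v))); last first.
      rewrite /gbump -!expRD; congr expR.
      rewrite !expr_div_n !sqr_sqrtr ?(ltW v0) ?(ltW v20)//.
      by field; rewrite gt_eqF.
    over.
  rewrite (gaussian_pair_gbump _ _ _ _ (lVV _ _ ij))//; last 2 first.
  - exact: measurable_funB.
  - exact: measurable_funD.
  rewrite /bump_pair -/v -/a mulrA.
  have E1 : 2 * v / (2 * v + 2) = v / (1 + z ^- 2 + w).
    rewrite (_ : 2 * v + 2 = 2 * (1 + z ^- 2 + w)); last by rewrite /v; ring.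
    by rewrite -mulf_div divff ?mul1r.
  have E2 : 2 * v / (2 * v + 2 * (1 - 2 * w)) = v / (1 + z ^- 2 - w).
    rewrite (_ : 2 * v + _ = 2 * (1 + z ^- 2 - w)); last by rewrite /v; ring.
    by rewrite -mulf_div divff ?mul1r.
  have E3 : (2 * a) ^+ 2 / (2 * (2 * v + 2 * (1 - 2 * w))) =
      a ^+ 2 / (1 + z ^- 2 - w).
    rewrite (_ : 2 * (2 * v + _) = 4 * (1 + z ^- 2 - w)); last by rewrite /v; ring.
    rewrite (_ : (2 * a) ^+ 2 = 4 * a ^+ 2); last by ring.
    by rewrite -mulf_div divff ?mul1r.
  by rewrite E1 E2 E3.
(* The narrow bump is the wide one times [exp (- (y - a) ^ 2 / (4 * v))], and [y <= a - eps] on the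
   event. *)
have fg t : [set t | forall i, V i t <= z - 2 * eps] t -> forall i,
    gbump ((V i t - a) / Num.sqrt v) <=
    expR (- (eps ^+ 2 / (4 * v))) * gbump ((V i t - a) / Num.sqrt (2 * v)).
  move=> /= Vt i; rewrite /gbump -expRD ler_expR.
  rewrite !expr_div_n !sqr_sqrtr ?(ltW v0) ?(ltW v20)//.
  rewrite -subr_ge0 (_ : _ - _ = ((V i t - a) ^+ 2 - eps ^+ 2) / (4 * v)); last first.
    by field; rewrite gt_eqF.
  apply: divr_ge0; last by rewrite mulr_ge0 ?ltW.
  by have := Vt i; rewrite /a; nra.
apply: (le_trans (second_moment_bound mA (leq_trans _ n2) G0 K0 (expR_ge0 _)
  (mb _) (mb _) (ga1 _) (ga1 _) fG gH fK fg)) => //.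
have h1 := bump_mean_lower w0 w2 z4 e0 ez nz.
rewrite invrK in h1.
have h2 := bump_pair_le eps w0 w2 z4.
have h3 := bump_wide_le w0 w2 z4 e0 ez nz.
(* So [K / G ^ 2 - 1] is at most [1 / n], the source of the term [4 / n]. *)
have h4 : 1 / (1 - w ^+ 2) - 1 <= w.
  by rewrite lerBlDr ler_pdivrMr; nra.
rewrite -/w -/v -mulrA in h3 *.
have -> : 64 / (eps ^+ 2 * z) = 4 * (16 / (eps ^+ 2 * z)) by ring.
have -> : 32 * expR 1 / (eps ^+ 2 * z ^+ 2) =
  2 * (16 * (expR 1 / (eps ^+ 2 * z ^+ 2))) by ring.
lra.
Qed.

End max_lower.

Lemma normal_law_le d (T : measurableType d) (R : realType)
    (P : probability T R) (Y : T -> R) (s y : R) : 0 < s ->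
  normal_law P Y 0 s -> P [set t | Y t <= y] = (Phi (y / s))%:E.
Proof.
move=> s0 lY; rewrite (_ : [set _ | _] = Y @^-1` `]-oo, y]%classic); last first.
  by apply/seteqP; split=> t; rewrite /= in_itv.
rewrite lY// EFin_Phi; congr (normal_prob 0 1 _).
by apply/seteqP; split=> t /=; rewrite !in_itv/= addr0 ler_pdivlMr// mulrC.
Qed.

(** * Equicorrelated Gaussian vectors *)

Section equicorrelated.
Context d (T : measurableType d) (R : realType) (P : probability T R) (n : nat).
Variables (X : 'I_n -> {RV P >-> R}) (rho : R).
Hypothesis hgauss : jointly_gaussian X.
Hypothesis hmarg : forall i, has_law P (X i) (normal_prob 0 1).
Hypothesis hcorr : forall i j, i != j -> correlation (X i) (X j) = rho.
Local Notation stdn := (@normal_prob R 0 1).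

Let lawX i : normal_law P (X i) 0 1.
Proof.
apply: normal_law_gaussian => //.
by rewrite /gaussian_law oner_eq0; exact: hmarg.
Qed.

Lemma integrable_marginal i : P.-integrable setT (EFin \o X i).
Proof.
apply: (normal_law_integrable _ (lawX i) (g := id)) => //.
by under eq_fun do rewrite mul1r addr0; exact: integrable_stdn_id.
Qed.

Lemma integrable_marginal_sqr i : P.-integrable setT (EFin \o (fun t => X i t ^+ 2)).
Proof.
apply: (normal_law_integrable _ (lawX i) (g := fun x => x ^+ 2)) => //.
by under eq_fun do rewrite mul1r addr0; exact: integrable_stdn_sqr.
Qed.

Lemma marginal_mean i : \int[P]_t X i t = 0.
Proof.
rewrite (Rintegral_normal_law _ (lawX i) (g := id))//.
  by under eq_Rintegral do rewrite mul1r addr0; exact: stdn_mean.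
by under eq_fun do rewrite mul1r addr0; exact: integrable_stdn_id.
Qed.

Lemma marginal_expectation i : ('E_P[X i] = 0)%E.
Proof.
rewrite unlock -[LHS]fineK; last exact: integrable_fin_num (integrable_marginal i).
by congr EFin; exact: marginal_mean.
Qed.

Lemma marginal_sqr i : \int[P]_t (X i t ^+ 2) = 1.
Proof.
rewrite (Rintegral_normal_law _ (lawX i) (g := fun x => x ^+ 2))//.
  by under eq_Rintegral do rewrite mul1r addr0; exact: stdn_sqr.
by under eq_fun do rewrite mul1r addr0; exact: integrable_stdn_sqr.
Qed.

Lemma fine_covariance_marginal i j :
  fine (covariance P (X i) (X j)) = \int[P]_t (X i t * X j t).
Proof.
rewrite unlock !marginal_expectation/= unlock; congr fine.
by apply: eq_integral => t _; rewrite /= fctE/= !subr0.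
Qed.

Lemma marginal_mul i j : i != j -> \int[P]_t (X i t * X j t) = rho.
Proof.
move=> ij; rewrite -(hcorr ij) /correlation /variance !fine_covariance_marginal.
have V k : \int[P]_t (X k t * X k t) = 1.
  by rewrite -(marginal_sqr k); apply: eq_Rintegral => t _; rewrite expr2.
by rewrite !V sqrtr1 mulr1 divr1.
Qed.

Lemma integrable_marginal_mul i j :
  P.-integrable setT (EFin \o (fun t => X i t * X j t)).
Proof.
have isum : P.-integrable setT (EFin \o (fun t => X i t ^+ 2 + X j t ^+ 2)).
  exact: (integrableD measurableT (integrable_marginal_sqr i)
    (integrable_marginal_sqr j)).
apply: (le_integrable measurableT _ _ isum).
  by apply/measurable_EFinP; exact: measurable_funM.
move=> t _; rewrite /= lee_fin [leRHS]ger0_norm ?addr_ge0 ?sqr_ge0//.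
rewrite ler_norml; have := sqr_ge0 (X i t + X j t); have := sqr_ge0 (X i t - X j t).
have := sqr_ge0 (X i t); have := sqr_ge0 (X j t).
by move=> *; apply/andP; split; lra.
Qed.

Definition lincomb (a : 'I_n -> R) (t : T) : R := \sum_(i < n) a i * X i t.

Lemma measurable_lincomb a : measurable_fun [set: T] (lincomb a).
Proof. by apply: measurable_sum => i; exact: measurable_funM. Qed.

Lemma lincomb_linear a b (x y : R) t :
  x * lincomb a t + y * lincomb b t = lincomb (fun i => x * a i + y * b i) t.
Proof.
rewrite /lincomb !mulr_sumr -big_split/=; apply: eq_bigr => i _; ring.
Qed.

Lemma lincomb_mean a : \int[P]_t lincomb a t = 0.
Proof.
rewrite /lincomb; under eq_Rintegral do rewrite -big_enum/=.
rewrite (@Rintegral_sum _ _ _ P _ _ (fun i t => a i * X i t)); last first.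
  by move=> i; exact: (integrableZl measurableT (a i) (integrable_marginal i)).
apply: big1 => i _; rewrite (RintegralZl _ measurableT (integrable_marginal i)).
by rewrite marginal_mean mulr0.
Qed.

Lemma lincomb_sqr a : \int[P]_t (lincomb a t ^+ 2) =
  (1 - rho) * \sum_(i < n) a i ^+ 2 + rho * (\sum_(i < n) a i) ^+ 2.
Proof.
have iij i j : P.-integrable setT (EFin \o (fun t => a i * a j * (X i t * X j t))).
  exact: (integrableZl measurableT (a i * a j) (integrable_marginal_mul i j)).
transitivity (\int[P]_t (\sum_(i <- enum 'I_n) \sum_(j <- enum 'I_n)
    a i * a j * (X i t * X j t))).
  apply: eq_Rintegral => t _; rewrite expr2 /lincomb -big_enum/= mulr_suml.
  apply: eq_bigr => i _; rewrite mulr_sumr; apply: eq_bigr => j _; ring.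
rewrite Rintegral_sum; last by move=> i; exact: integrable_Rsum.
under eq_bigr do rewrite Rintegral_sum//.
have E i j : \int[P]_t (a i * a j * (X i t * X j t)) =
    rho * (a i * a j) + (i == j)%:R * ((1 - rho) * a i ^+ 2).
  rewrite (RintegralZl _ measurableT (integrable_marginal_mul i j)).
  have [->|ij] := eqVneq i j; last by rewrite marginal_mul//=; ring.
  rewrite (_ : \int[P]_t _ = 1); first by rewrite /=; ring.
  by rewrite -(marginal_sqr j); apply: eq_Rintegral => t _; rewrite expr2.
under eq_bigr do under eq_bigr do rewrite E.
rewrite big_enum/= [RHS]addrC expr2 mulr_suml !mulr_sumr -big_split/=.
apply: eq_bigr => i _; rewrite big_enum/= big_split/= -!mulr_sumr; congr (_ + _).
rewrite (bigD1 i)//= eqxx mul1r big1 ?addr0// => j ji.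
by rewrite eq_sym (negbTE ji) mul0r.
Qed.

(** Joint normality gives the shape of the law with unknown [m] and [s]; the first two moments of
    the combination identify them. *)
Lemma normal_law_lincomb a : normal_law P (lincomb a) 0
  (Num.sqrt ((1 - rho) * \sum_(i < n) a i ^+ 2 + rho * (\sum_(i < n) a i) ^+ 2)).
Proof.
have [m [s [s0 hl]]] := hgauss a.
have lY : normal_law P (lincomb a) m s := normal_law_gaussian s0 hl.
have isz : stdn.-integrable setT (EFin \o (fun z : R => s * z)).
  exact: (integrableZl _ _ integrable_stdn_id).
have icst (c : R) : stdn.-integrable setT (EFin \o (fun _ : R => c)).
  by apply: (@integrable_stdn_bounded _ `|c|).
have m0 : m = 0.
  have := lincomb_mean a.
  rewrite (Rintegral_normal_law (measurable_lincomb a) lY (g := id))//; last first.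
    exact: (integrableD measurableT isz (icst m)).
  rewrite (RintegralD measurableT isz (icst m)) Rintegral_probability_cst.
  by rewrite (RintegralZl _ measurableT integrable_stdn_id) stdn_mean mulr0 add0r.
rewrite m0 in lY.
have isz2 : stdn.-integrable setT (EFin \o (fun z : R => s ^+ 2 * z ^+ 2)).
  exact: (integrableZl _ _ integrable_stdn_sqr).
rewrite -lincomb_sqr.
rewrite (Rintegral_normal_law (measurable_lincomb a) lY (g := fun x => x ^+ 2))//; last first.
  by under eq_fun do rewrite addr0 exprMn.
under eq_Rintegral do rewrite addr0 exprMn.
rewrite (RintegralZl _ measurableT integrable_stdn_sqr) stdn_sqr mulr1.
by rewrite sqrtr_sqr ger0_norm.
Qed.

End equicorrelated.

Lemma sum_indicator (R : pzRingType) (n : nat) (i : 'I_n) (f : 'I_n -> R) :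
  \sum_(k < n) (k == i)%:R * f k = f i.
Proof.
rewrite (bigD1 i)//= eqxx mul1r big1 ?addr0// => k /negbTE ->.
by rewrite mul0r.
Qed.

(** * Two-sided bounds for the exceedance probability *)

Section two_sided_bound.
Context d (T : measurableType d) (R : realType) (P : probability T R) (n : nat).
Variables (X : 'I_n -> {RV P >-> R}) (rho : R).

(** With [Y] the opposite of the sample mean, exceedance by [X_i] reads
    [Y < sqrt rho * q + tau * (V_i - z)]. Bounding the largest [V_i] between [z - 2 * eps] and
    [z + eps], off sets of small probability, leaves events in [Y] alone, and [sigma ^ 2] is the
    variance of [Y]. *)
Lemma exceedance_bounds (q eps : R) : (2 <= n)%N -> 0 < rho < 1 ->
  jointly_gaussian X -> (forall i, has_law P (X i) (normal_prob 0 1)) ->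
  (forall i j, i != j -> correlation (X i) (X j) = rho) ->
  let z := Phi_inv (1 - n%:R^-1) in
  let sigma := Num.sqrt (rho + (1 - rho) / n%:R) in
  let tau := Num.sqrt (1 - rho) in
  let p := fine (P (\bigcup_(i in [set: 'I_n])
    [set t | tau * z - Num.sqrt rho * q < X i t])) in
  4 <= z -> 0 < eps -> eps <= z ->
  Phi ((Num.sqrt rho * q - 2 * tau * eps) / sigma) -
    (64 / (eps ^+ 2 * z) + 4 / n%:R + 32 * expR 1 / (eps ^+ 2 * z ^+ 2)) <= p /\
  p <= Phi ((Num.sqrt rho * q + tau * eps) / sigma) + 1 / (eps * z).
Proof.
move=> n2 /andP[rho0 rho1] hgauss hmarg hcorr z sigma tau p z4 e0 ez.
have nR0 : 0 < n%:R :> R by rewrite ltr0n (leq_trans _ n2).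
pose w : R := n%:R^-1; have w0 : 0 < w by rewrite invr_gt0.
have w2 : w <= 1 / 2 by rewrite div1r lef_pV2 ?posrE// ler_nat.
have wn : n%:R * w = 1 by rewrite mulfV// gt_eqF.
have tau0 : 0 < tau by rewrite sqrtr_gt0 subr_gt0.
have tau2 : tau ^+ 2 = 1 - rho by rewrite sqr_sqrtr// subr_ge0 ltW.
have sigma0 : 0 < sigma.
  by rewrite sqrtr_gt0 ltr_pwDl// divr_ge0 ?subr_ge0//; exact: ltW.
have z0 : 0 < z by lra.
have zE : 1 - Phi z = w.
  by rewrite Phi_invK ?opprB ?subrKC// -/w; apply/andP; split; lra.
have nz : w * expR (z ^+ 2 / 2) <= 1.
  have := Phi_tail_chernoff (ltW z0); rewrite zE expRN.
  by rewrite -ler_pdivlMr ?expR_gt0// div1r.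
pose L := lincomb X.
pose c (i k : 'I_n) : R := ((k == i)%:R - w) / tau.
pose V i := L (c i).
(* The minus sign gives the events below the form [Y <= x], whose probability is a value of
   [Phi]. *)
pose Y := L (fun=> - w).
have sumw (x : R) : \sum_(k < n) x = n%:R * x.
  by rewrite sumr_const card_ord mulr_natl.
(* Coefficients of sum zero cancel the [rho] term in [normal_law_lincomb], leaving [tau ^ 2] times
   the inner products of coefficient vectors. *)
have sumc i : \sum_(k < n) c i k = 0.
  rewrite -mulr_suml sumrB sumw wn.
  have := sum_indicator i (fun=> 1 : R); under eq_bigr do rewrite mulr1.
  by move=> ->; rewrite subrr mul0r.
have sumcc i j : \sum_(k < n) c i k * c j k = ((i == j)%:R - w) / tau ^+ 2.
  transitivity (\sum_(k < n) ((k == i)%:R * (((k == j)%:R - w) / tau ^+ 2) -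
      w / tau ^+ 1 * c j k)).
    by apply: eq_bigr => k _; rewrite /c expr1; field; rewrite gt_eqF.
  by rewrite sumrB sum_indicator -mulr_sumr sumc mulr0 subr0.
have sumcc2 i : \sum_(k < n) c i k ^+ 2 = (1 - w) / tau ^+ 2.
  by have := sumcc i i; rewrite eqxx => <-; apply: eq_bigr => k _; rewrite expr2.
have lV i : normal_law P (V i) 0 (Num.sqrt (1 - w)).
  have := normal_law_lincomb hgauss hmarg hcorr (c i).
  rewrite sumc expr0n mulr0 addr0 sumcc2 (_ : _ * _ = 1 - w)//.
  by rewrite tau2 mulrC divfK// gt_eqF// subr_gt0.
have lVV i j : i != j -> forall t s : R,
    normal_law P (fun o => t * (V i o - V j o) + s * (V i o + V j o)) 0
      (Num.sqrt (t ^+ 2 * 2 + s ^+ 2 * (2 * (1 - 2 * w)))).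
  move=> ij t s.
  have -> : (fun o => t * (V i o - V j o) + s * (V i o + V j o)) =
      L (fun k => (t + s) * c i k + (s - t) * c j k).
    by apply/funext => o; rewrite /V /L -lincomb_linear; ring.
  have := normal_law_lincomb hgauss hmarg hcorr
    (fun k => (t + s) * c i k + (s - t) * c j k).
  rewrite big_split/= -!mulr_sumr !sumc !mulr0 addr0 expr0n mulr0 addr0.
  have -> : \sum_(k < n) ((t + s) * c i k + (s - t) * c j k) ^+ 2 =
      (t + s) ^+ 2 * ((1 - w) / tau ^+ 2) +
      2 * (t + s) * (s - t) * (- w / tau ^+ 2) +
      (s - t) ^+ 2 * ((1 - w) / tau ^+ 2).
    rewrite -[X in (t + s) ^+ 2 * X](sumcc2 i) -[X in (s - t) ^+ 2 * X](sumcc2 j).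
    have := sumcc i j; rewrite (negbTE ij) sub0r => <-.
    rewrite !mulr_sumr -!big_split/=; apply: eq_bigr => k _; ring.
  rewrite (_ : (1 - rho) * _ = t ^+ 2 * 2 + s ^+ 2 * (2 * (1 - 2 * w)))//.
  by rewrite -tau2; field; rewrite gt_eqF.
have lY : normal_law P Y 0 sigma.
  have := normal_law_lincomb hgauss hmarg hcorr (fun=> - w).
  rewrite !sumw (_ : (1 - rho) * _ + _ = rho + (1 - rho) / n%:R)//.
  by rewrite /w; field; rewrite gt_eqF.
have XE i t : X i t = tau * V i t - Y t.
  rewrite -[- Y t]mulN1r /V /Y /L lincomb_linear /lincomb.
  rewrite -(sum_indicator i (fun k => X k t)).
  by apply: eq_bigr => k _; rewrite /c; field; rewrite gt_eqF.
have mL a : measurable_fun [set: T] (L a) by exact: measurable_lincomb.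
have mle (Z : T -> R) x : measurable_fun [set: T] Z -> measurable [set t | Z t <= x].
  move=> mZ; rewrite (_ : [set _ | _] = setT `&` (Z @^-1` `]-oo, x]%classic)).
    exact: mZ.
  by apply/seteqP; split=> t; rewrite /= in_itv/=; [split|case].
have mgt (Z : T -> R) x : measurable_fun [set: T] Z -> measurable [set t | x < Z t].
  move=> mZ; rewrite (_ : [set _ | _] = ~` [set t | Z t <= x]).
    by apply: measurableC; exact: mle.
  by apply/seteqP; split=> t /=; rewrite ltNge => /negP.
pose cn := tau * z - Num.sqrt rho * q.
pose E := \bigcup_(i in [set: 'I_n]) [set t | cn < X i t].
have mE : measurable E by apply: fin_bigcup_measurable => // i _; exact: mgt.
pose A := [set o | forall i, V i o <= z - 2 * eps].
have mA : measurable A.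
  rewrite (_ : A = \bigcap_(i in [set: 'I_n]) [set o | V i o <= z - 2 * eps]).
    by apply: fin_bigcap_measurable => // i _; exact: (mle _ _ (mL _)).
  apply/seteqP; split=> t Vt i; first by move=> _; exact: (Vt i).
  exact: (Vt i Logic.I).
have pE : P E = p%:E by rewrite fineK// fin_num_measure.
have PA := all_small_probability n2 z4 e0 ez nz (fun i => mL (c i)) lV lVV.
pose F1 := [set t | Y t <= Num.sqrt rho * q - 2 * tau * eps].
pose F2 := [set t | Y t <= Num.sqrt rho * q + tau * eps].
split.
- have sub : F1 `<=` E `|` A.
    move=> t; rewrite /F1/= => Yt; have [At|] := pselect (A t); first by right.
    move=> /existsNP[i /negP]; rewrite -ltNge => Vi; left; exists i => //=.
    by rewrite XE /cn; nra.
  have : (P F1 <= P E + P A)%E.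
    apply: le_trans (measureU2 _ mE mA).
    by apply: le_measure; rewrite ?inE//; [exact: (mle _ _ (mL _))|exact: measurableU].
  rewrite /F1 (normal_law_le _ sigma0 lY) pE -[P A]fineK ?fin_num_measure//.
  rewrite -EFinD lee_fin; lra.
- pose B i := [set t | z + eps < V i t].
  pose BU := \bigcup_(i in [set: 'I_n]) B i.
  have mB i : measurable (B i) by exact: (mgt _ _ (mL _)).
  have sub : E `<=` F2 `|`
      BU.
    move=> t [i _ /=]; rewrite XE /cn => Xi.
    have [Vi|Vi] := ltP (z + eps) (V i t); first by right; exists i.
    by left; rewrite /F2/=; nra.
  (* [V i] has variance below 1, so its tail is at most the standard one. As
     [1 - Phi z = w = 1 / n], shifting by [eps] leaves [w * exp (- eps * z)], and summation over [i]
     cancels [w]. *)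
  have PB i : (P (B i) <= (w * expR (- (eps * z)))%:E)%E.
    have s0 : 0 < Num.sqrt (1 - w) by rewrite sqrtr_gt0; lra.
    have -> : B i = ~` [set t | V i t <= z + eps].
      by apply/seteqP; split=> t; rewrite /B/= ltNge => /negP.
    rewrite probability_setC//; last exact: (mle _ _ (mL _)).
    rewrite (normal_law_le _ s0 (lV i)) -EFinB lee_fin.
    apply: (@le_trans _ _ (1 - Phi (z + eps))).
      have s1 : Num.sqrt (1 - w) <= 1 by apply: sqrtr_le => //; rewrite expr1n; lra.
      rewrite lerB// Phi_nondecreasing// ler_pdivlMr// ler_piMr//.
      by rewrite ltW// addr_gt0.
    apply: (le_trans (Phi_tail_shift z (ltW e0))); rewrite zE mulrC.
    apply: ler_wpM2l; first exact: ltW.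
    by rewrite ler_expR lerN2 lerDl divr_ge0 ?sqr_ge0.
  have mU : measurable BU.
    by apply: fin_bigcup_measurable.
  have PBU : (P BU <= (1 / (eps * z))%:E)%E.
    apply: (@le_trans _ _ (\sum_(i < n) P (B i))%E).
      have enumT : [set` enum 'I_n] = [set: 'I_n].
        by apply/seteqP; split=> i //= _; rewrite mem_enum.
      rewrite -big_enum/= fsbig_seq ?enum_uniq// enumT.
      by apply: content_sub_fsum => //; exact: finite_finset.
    apply: (@le_trans _ _ (\sum_(i < n) (w * expR (- (eps * z)))%:E)%E).
      by apply: lee_sum => i _; exact: PB.
    rewrite sumEFin sumw mulrA wn mul1r lee_fin expRN div1r.
    rewrite lef_pV2 ?posrE ?expR_gt0 ?mulr_gt0//.
    by apply: le_trans (expR_ge1Dx _); rewrite lerDr.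
  have : (P E <= P F2 +
      P BU)%E.
    apply: le_trans (measureU2 _ _ mU); last exact: (mle _ _ (mL _)).
    by apply: le_measure; rewrite ?inE//; apply: measurableU => //; exact: (mle _ _ (mL _)).
  move=> /le_trans /(_ (leeD2l _ PBU)).
  by rewrite /F2 (normal_law_le _ sigma0 lY) pE -EFinD lee_fin.
Qed.

End two_sided_bound.

(** * Passage to the limit *)

Lemma cvg_Phi_ratio (R : realType) (rho x : R) : 0 < rho ->
  Phi (x / Num.sqrt (rho + (1 - rho) / n%:R)) @[n --> \oo] -->
  Phi (x / Num.sqrt rho).
Proof.
move=> rho0.
have c1 : rho + (1 - rho) / n%:R @[n --> \oo] --> rho.
  rewrite -[X in _ --> X]addr0; apply: cvgD; first exact: cvg_cst.
  rewrite -[X in _ --> X](mulr0 (1 - rho)); apply: cvgMr.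
  apply/gtr0_cvgV0; last exact: cvgr_idn.
  by near=> n; rewrite ltr0n; near: n; exact: nbhs_infty_gt.
have c2 : Num.sqrt (rho + (1 - rho) / n%:R) @[n --> \oo] --> Num.sqrt rho.
  exact: (cvg_comp _ _ c1 (@sqrt_continuous R rho)).
have c3 : x / Num.sqrt (rho + (1 - rho) / n%:R) @[n --> \oo] --> x / Num.sqrt rho.
  by apply: cvgMr; apply: cvgV => //; rewrite gt_eqF// sqrtr_gt0.
exact: (cvg_comp _ _ c3 (@continuous_Phi R _)).
Unshelve. all: by end_near. Qed.

Theorem theorem3p1 (R : realType) (rho alpha : R)
    (hrho : 0 < rho < 1) (halpha : 0 < alpha < 1)
    (d : nat -> measure_display) (T : forall n : nat, measurableType (d n))
    (P : forall n : nat, probability (T n) R)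
    (X : forall n : nat, 'I_n -> {RV (P n) >-> R})
    (hgauss : forall n : nat, (2 <= n)%N -> jointly_gaussian (X n))
    (hmarg : forall n : nat, (2 <= n)%N ->
       forall i : 'I_n, has_law (P n) (X n i) (normal_prob 0 1))
    (hcorr : forall n : nat, (2 <= n)%N ->
       forall i j : 'I_n, i != j -> correlation (X n i) (X n j) = rho) :
  FWER (X n) (cutoff_procedure (X n) (cutoff n alpha rho)) @[n --> \oo]
    --> alpha%:E
  /\
  P n (\bigcup_(i in [set: 'I_n]) [set t | cutoff n alpha rho < X n i t])
    @[n --> \oo] --> alpha%:E.
Proof.
suff lim : P n (\bigcup_(i in [set: 'I_n]) [set t | cutoff n alpha rho < X n i t])
    @[n --> \oo] --> alpha%:E.
  (* From [n = 2] on all means vanish, so every null hypothesis is true and the two events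
     coincide. *)
  split=> //; apply: cvg_trans lim; apply: near_eq_cvg; near=> n.
  have n2 : (2 <= n)%N by near: n; exact: nbhs_infty_ge.
  rewrite /FWER (_ : true_nulls (X n) = setT)//.
  by apply/seteqP; split=> i //= _; exact: marginal_expectation (hmarg n n2) i.
apply/fine_cvgP; split.
  apply: nearW => n; apply: fin_num_measure; apply: fin_bigcup_measurable => // i _.
  rewrite (_ : [set _ | _] = setT `&` (X n i @^-1` `]cutoff n alpha rho, +oo[%classic)).
    exact: measurable_funP.
  by apply/seteqP; split=> t; rewrite /= in_itv/= andbT; [split|case].
have [rho0 rho1] := andP hrho.
have sr0 : 0 < Num.sqrt rho by rewrite sqrtr_gt0.
have tau0 : 0 < Num.sqrt (1 - rho) by rewrite sqrtr_gt0 subr_gt0.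
have pk0 : 0 < normal_peak 1 :> R by rewrite normal_peak_gt0 ?oner_eq0.
set q := Phi_inv alpha; set tau := Num.sqrt (1 - rho) in tau0 *.
have Phiq : Phi q = alpha by exact: Phi_invK.
apply/cvgrPdist_le => /= e e0.
(* The error budget: [e / 2] for displacing the threshold by a multiple of [eps], [e / 4] for
   replacing [sigma] by [sqrt rho], and [e / 12] for each of the at most three remainders on either
   side. *)
have close (Au Al Bu Bl b1 b2 b3 b4 p : R) :
    `|Au - alpha| <= e / 2 -> `|Al - alpha| <= e / 2 ->
    `|Au - Bu| <= e / 4 -> `|Al - Bl| <= e / 4 ->
    b1 <= e / 12 -> b2 <= e / 12 -> b3 <= e / 12 -> b4 <= e / 12 ->
    Bl - (b2 + b3 + b4) <= p -> p <= Bu + b1 -> `|alpha - p| <= e.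
  clear -e0; rewrite !ler_norml.
  move=> /andP[a1 a2] /andP[a3 a4] /andP[a5 a6] /andP[a7 a8] *.
  by apply/andP; split; lra.
(* [normal_peak 1] is the Lipschitz constant of [Phi], and [2 * tau * eps] is the larger of the two
   displacements; [eps] stays fixed while [n] grows. *)
have [eps eps0 epsE] : exists2 eps : R, 0 < eps &
    normal_peak 1 * (2 * tau * eps / Num.sqrt rho) = e / 2.
  exists (e * Num.sqrt rho / (4 * normal_peak 1 * tau)).
    by rewrite divr_gt0 ?mulr_gt0.
  by field; rewrite !gt_eqF.
have e4 : 0 < e / 4 by rewrite divr_gt0.
have Phi_near h : `|h| <= 2 * tau * eps ->
    `|Phi ((Num.sqrt rho * q + h) / Num.sqrt rho) - alpha| <= e / 2.
  move=> hh; rewrite -Phiq; apply: (le_trans (Phi_lipschitz _ _)).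
  rewrite -epsE ler_pM2l// (_ : _ - q = h / Num.sqrt rho).
    by rewrite normrM (gtr0_norm (_ : 0 < (Num.sqrt rho)^-1)) ?invr_gt0// ler_pM2r ?invr_gt0.
  by field; rewrite gt_eqF.
have te0 : 0 < tau * eps by rewrite mulr_gt0.
have up : `|Phi ((Num.sqrt rho * q + tau * eps) / Num.sqrt rho) - alpha| <= e / 2.
  by apply: Phi_near; rewrite gtr0_norm//; lra.
have lo : `|Phi ((Num.sqrt rho * q - 2 * tau * eps) / Num.sqrt rho) - alpha| <= e / 2.
  by apply: Phi_near; rewrite normrN gtr0_norm//; lra.
have /cvgryPge cz := @cvg_Phi_inv_oneBV R.
have small (C : R) : 0 < C -> \forall n \near \oo, C / Phi_inv (1 - n%:R^-1) <= e / 12.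
  move=> C0; near=> n.
  have z1 : 1 <= Phi_inv (1 - n%:R^-1 : R) by near: n; exact: cz.
  rewrite ler_pdivrMr ?(lt_le_trans ltr01)// mulrC -ler_pdivrMr ?divr_gt0//.
  by near: n; exact: cz.
have upn : \forall n \near \oo,
    `|Phi ((Num.sqrt rho * q + tau * eps) / Num.sqrt rho) -
      Phi ((Num.sqrt rho * q + tau * eps) / Num.sqrt (rho + (1 - rho) / n%:R))| <= e / 4.
  by have /cvgrPdist_le := @cvg_Phi_ratio R rho (Num.sqrt rho * q + tau * eps) rho0; apply.
have lon : \forall n \near \oo,
    `|Phi ((Num.sqrt rho * q - 2 * tau * eps) / Num.sqrt rho) -
      Phi ((Num.sqrt rho * q - 2 * tau * eps) / Num.sqrt (rho + (1 - rho) / n%:R))| <= e / 4.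
  by have /cvgrPdist_le := @cvg_Phi_ratio R rho (Num.sqrt rho * q - 2 * tau * eps) rho0; apply.
have c1 : 0 < 1 / eps by rewrite divr_gt0.
have c2 : 0 < 64 / eps ^+ 2 by rewrite divr_gt0// exprn_gt0.
have c3 : 0 < 32 * expR 1 / eps ^+ 2.
  by rewrite divr_gt0 ?exprn_gt0// mulr_gt0// expR_gt0.
near=> n.
have n2 : (2 <= n)%N by near: n; exact: nbhs_infty_ge.
(* This is [4 / n <= e / 12]. *)
have n48 : 48 / e <= n%:R by near: n; exact: nbhs_infty_ger.
have z4 : 4 <= Phi_inv (1 - n%:R^-1 : R) by near: n; exact: cz.
have zeps : eps <= Phi_inv (1 - n%:R^-1 : R) by near: n; exact: cz.
have s1 : 1 / eps / Phi_inv (1 - n%:R^-1) <= e / 12 by near: n; exact: small.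
have s2 : 64 / eps ^+ 2 / Phi_inv (1 - n%:R^-1) <= e / 12 by near: n; exact: small.
have s3 : 32 * expR 1 / eps ^+ 2 / Phi_inv (1 - n%:R^-1) <= e / 12.
  by near: n; exact: small.
have u4 : `|Phi ((Num.sqrt rho * q + tau * eps) / Num.sqrt rho) -
    Phi ((Num.sqrt rho * q + tau * eps) / Num.sqrt (rho + (1 - rho) / n%:R))| <= e / 4.
  by near: n.
have l4 : `|Phi ((Num.sqrt rho * q - 2 * tau * eps) / Num.sqrt rho) -
    Phi ((Num.sqrt rho * q - 2 * tau * eps) / Num.sqrt (rho + (1 - rho) / n%:R))| <= e / 4.
  by near: n.
have [L U] := exceedance_bounds q n2 hrho (hgauss n n2) (hmarg n n2) (hcorr n n2)
  z4 eps0 zeps.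
rewrite -/tau in L U; rewrite /cutoff -/q -/tau.
set z := Phi_inv (1 - n%:R^-1) in z4 zeps s1 s2 s3 L U *.
move: (fine _) L U => p L U.
have z0 : 0 < z := lt_le_trans (ltr0n _ 4) z4.
have t1 : 1 / (eps * z) <= e / 12 by rewrite invfM mulrA.
have t2 : 64 / (eps ^+ 2 * z) <= e / 12 by rewrite invfM mulrA.
have t3 : 32 * expR 1 / (eps ^+ 2 * z ^+ 2) <= e / 12.
  apply: le_trans s3; rewrite -[leRHS]mulrA -invfM ler_wpM2l ?mulr_ge0 ?expR_ge0//.
  rewrite lef_pV2 ?posrE ?mulr_gt0 ?exprn_gt0//.
  rewrite ler_pM2l ?exprn_gt0// expr2 ler_peMl ?(ltW z0)//.
  by apply: le_trans z4; rewrite ler1n.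
have t4 : 4 / n%:R <= e / 12.
  have n0 : 0 < n%:R :> R by rewrite ltr0n (leq_trans _ n2).
  by rewrite ler_pdivrMr//; move: n48; rewrite ler_pdivrMr//; clear -e0; lra.
exact: (close _ _ _ _ _ _ _ _ _ up lo u4 l4 t1 t2 t4 t3 L U).
Unshelve. all: by end_near. Qed.
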